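(* For any constant $p>0$ (with $p\le 1$), the Best-of-two and the Best-of-three on the Erdős–Rényi graph $G(n,p)$ reach consensus within $O(\log n)$ steps w.h.p. for all initial opinion configurations. That is, w.h.p. over the random graph $G(n,p)$ with vertex set $V$, for each of the two processes, for every set $A\subseteq V$ of vertices initially holding opinion $1$, one has $T_{\mathrm{cons}}(A)=O(\log n)$ w.h.p. over the voting process.
   Context: $G(n,p)$ is the random graph on $n$ vertices where each pair of distinct vertices is joined by an edge independently with probability $p$. The graph is generated first and then kept fixed. Each vertex holds an opinion in $\{1,2\}$. In each synchronous discrete step, every vertex independently updates as follows. Best-of-two: it samples two uniformly random neighbors (with replacement) and, if both hold the same opinion, adopts it; otherwise it keeps its own opinion. Best-of-three: it samples three uniformly random neighbors (with replacement) and adopts the majority opinion among them. $A^{(t)}$ is the set of vertices with opinion 1 after $t$ steps, and $T_{\mathrm{cons}}(A)=\min\{t\ge0: A^{(t)}\in\{\emptyset,V\},\ A^{(0)}=A\}$. ''W.h.p.'' means with probability at least $1-n^{-c}$ for some constant $c>0$ (asymptotics as $n\to\infty$); the constants, including the one hidden in $O(\log n)$, do not depend on $n$ or on $A$. *)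

(* Defs.v *)
From mathcomp Require Import all_boot all_order all_algebra.
From mathcomp Require Import boolp classical_sets reals ereal topology.
From mathcomp Require Import normedtype sequences exp measure probability.

Set Implicit Arguments.
Unset Strict Implicit.
Unset Printing Implicit Defensive.

Import Order.TTheory GRing.Theory Num.Theory.

Local Open Scope ring_scope.

(* A simple graph on 'I_n is its set of edges, an edge being a 2-subset of
   'I_n, so that symmetry and the absence of loops are built in. *)
Definition vpair (n : nat) : finType := {e : {set 'I_n} | #|e| == 2%N}.

Definition graph (n : nat) : finType := {set vpair n}.

Definition neighbors (n : nat) (G : graph n) (v : 'I_n) : {set 'I_n} :=
  [set u : 'I_n | [exists e in G, val e == [set u; v]%SET]]%SET.

Definition gnp_mass (R : realType) (p : R) (n : nat) (G : graph n) : R :=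
  \prod_(e : vpair n) (if e \in G then p else 1 - p).

Definition gnp_prob (R : realType) (p : R) (n : nat) (E : set (graph n)) : R :=
  \sum_(G : graph n | `[< E G >]) gnp_mass p G.

Inductive voting := BestOfTwo | BestOfThree.

Definition samples (m : voting) : nat :=
  match m with BestOfTwo => 2 | BestOfThree => 3 end.

(* [true] stands for opinion 1 and [false] for opinion 2; [own] is the current
   opinion of the vertex and [s] lists the opinions of the sampled neighbors. *)
Definition new_opinion (m : voting) (own : bool) (s : seq bool) : bool :=
  match m with
  | BestOfTwo => if nth own s 0 == nth own s 1 then nth own s 0 else own
  | BestOfThree => (2 <= count id s)%N
  end.

(* The probability that [v] holds opinion 1 after one step from [A]: the
   proportion, among the tuples of neighbors of [v], of those that give [v]
   opinion 1. An isolated vertex has nobody to sample and keeps its opinion. *)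
Definition opinion1_prob (R : realType) (m : voting) (n : nat) (G : graph n)
    (A : {set 'I_n}) (v : 'I_n) : R :=
  let N := neighbors G v in
  if N == finset.set0 then (v \in A)%:R else
  #|[set s : (samples m).-tuple 'I_n |
      all (fun u => u \in N) s &&
      new_opinion m (v \in A) [seq u \in A | u <- s]]%SET|%:R
  / (#|N| ^ samples m)%:R.

(* Given [A], the vertices update independently. *)
Definition step_prob (R : realType) (m : voting) (n : nat) (G : graph n)
    (A B : {set 'I_n}) : R :=
  \prod_(v : 'I_n) (if v \in B then opinion1_prob R m G A v
                    else 1 - opinion1_prob R m G A v).

Local Open Scope classical_set_scope.

(* [X t] is the set of vertices with opinion 1 after t steps: X is a Markov
   chain started from [A] with transition probabilities [step_prob]. *)
Record voting_process (R : realType) (m : voting) (n : nat) (G : graph n)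
    (A : {set 'I_n}) (d : measure_display) (T : measurableType d)
    (P : probability T R) (X : nat -> T -> {set 'I_n}) : Prop := VotingProcess {
  voting_meas : forall t B, measurable [set w | X t w = B];
  voting_init : P [set w | X 0%N w = A] = 1%E;
  voting_step : forall (t : nat) (B : nat -> {set 'I_n}),
    P [set w | forall s, (s <= t.+1)%N -> X s w = B s] =
    (P [set w | forall s, (s <= t)%N -> X s w = B s] *
     (step_prob R m G (B t) (B t.+1))%:E)%E }.

Definition consensus (n : nat) (A : {set 'I_n}) : bool :=
  (A == finset.set0) || (A == finset.setTfor 'I_n).

(* +oo when consensus is never reached *)
Definition consensus_time (R : realType) (n : nat) (T : Type)
    (X : nat -> T -> {set 'I_n}) (w : T) : \bar R :=
  match pselect (exists t, consensus (X t w)) with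
  | left reached => ((ex_minn reached)%:R)%:E
  | right _ => +oo%E
  end.

(* Main.v *)
Require Import Defs.
From mathcomp Require Import all_boot all_order all_algebra.
From mathcomp Require Import boolp classical_sets reals ereal topology.
From mathcomp Require Import normedtype sequences exp measure probability.
From mathcomp Require Import ring lra.

Set Implicit Arguments.
Unset Strict Implicit.
Unset Printing Implicit Defensive.

Import Order.TTheory GRing.Theory Num.Theory.

Local Open Scope ring_scope.

(** Write opinions as signs [s v = 1] or [-1], let [pi] be the stationary law
    of the random walk on the graph and [P] its transition matrix, and call
    [delta], the [pi]-average of [s], the bias. A vertex that samples its
    neighbours only sees the local average [z = P s], and both voting rules
    have the same mean field: if every [z v] were equal to [delta], the bias
    would move on average to [(3 * delta - delta ^ 3) / 2], so that it grows
    by a constant factor until consensus is near, and the minority then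
    shrinks by a constant factor. Three things have to be controlled.

    Graph. A graph with minimum degree at least [c * n] whose deviation matrix
    (adjacency minus [p]) has small fourth Schatten norm is an expander: [P]
    contracts the functions of mean zero by a small constant [lam]
    ([quasirandom_expander]). Fourth moments of degrees and second moments of
    codegrees, with Markov's inequality, give this with probability
    [1 - O(1 / n)] ([gnp_quasirandom]).

    Unevenness. The difference between the mean field and the truth is
    governed by the unevenness, the variance of the local averages [z]. A
    constant gap suffices to make its expectation contract by [3 / 4] in each
    step up to the noise [O(1 / n)] ([unevenness_step]). After [O(log n)]
    steps it is therefore [O(1 / n)] on average, far below the threshold
    [n ^ (- 1 / 2)] at which it could compete with the random fluctuations of
    the bias.

    Bias. While the unevenness is below this threshold, the potential
    [(1 - delta ^ 2) / (K / n + delta ^ 2)] decreases on average by a constant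
    factor whatever the value of the bias ([potential_step]): near balance
    because one step changes the bias by about [n ^ (- 1 / 2)] at random, and
    elsewhere because of the drift. The regularisation [K / n] is what makes
    the first effect visible while keeping the second order term of a Taylor
    expansion small. This single potential, never more than [n / K] and at
    least [c / n] before consensus, spares a separate treatment of balanced,
    biased and nearly unanimous configurations.

    A burn-in for the unevenness followed by as many steps for the potential
    gives the theorem; the failure probability is that of a state of large
    unevenness during the second half, bounded by Markov's inequality at each
    time ([evolve_unfinished]). *)

(** * Moments of independent Bernoulli variables *)

Section Bernoulli.
Variables (R : realFieldType) (I : finType).
Implicit Types (q c : I -> R) (F G : {set I} -> R) (B : {set I}).

(** Random graphs, as sets of pairs, and the outcome of a voting step, as a
    set of vertices, both follow such a product law. *)
Definition bernoulli_mass q B : R :=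
  \prod_i (if i \in B then q i else 1 - q i).

Definition bexp q F : R := \sum_(B : {set I}) bernoulli_mass q B * F B.

Lemma eq_bexp q F G : F =1 G -> bexp q F = bexp q G.
Proof. by move=> FG; apply: eq_bigr => B _; rewrite FG. Qed.

Lemma bexpD q F G : bexp q (fun B => F B + G B) = bexp q F + bexp q G.
Proof. by rewrite /bexp -big_split; apply: eq_bigr => B _; rewrite mulrDr. Qed.

Lemma bexpZ q a F : bexp q (fun B => a * F B) = a * bexp q F.
Proof. by rewrite /bexp mulr_sumr; apply: eq_bigr => B _; rewrite mulrCA. Qed.

Lemma bexp_sum q (J : Type) (r : seq J) (D : pred J) (F : J -> {set I} -> R) :
  bexp q (fun B => \sum_(j <- r | D j) F j B) =
  \sum_(j <- r | D j) bexp q (F j).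
Proof.
by rewrite /bexp exchange_big; apply: eq_bigr => B _; rewrite mulr_sumr.
Qed.

Lemma bexp1 q : bexp q (fun=> 1) = 1.
Proof.
rewrite /bexp; under eq_bigr do rewrite mulr1.
rewrite -(bigA_distr _ _ q (fun i => 1 - q i)).
by rewrite big1 // => i _ /=; ring.
Qed.

Lemma bexp_cst q a : bexp q (fun=> a) = a.
Proof.
by rewrite -[RHS]mulr1 -(bexp1 q) -bexpZ; apply: eq_bexp => B; rewrite mulr1.
Qed.

Definition prob_vector q := forall i, 0 <= q i <= 1.

Lemma bernoulli_mass_ge0 q B : prob_vector q -> 0 <= bernoulli_mass q B.
Proof.
move=> q01; apply: prodr_ge0 => i _; have /andP[q0 q1] := q01 i.
by case: ifP => // _; rewrite subr_ge0.
Qed.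

Lemma ler_bexp q F G :
  prob_vector q -> (forall B, F B <= G B) -> bexp q F <= bexp q G.
Proof.
move=> q01 FG; apply: ler_sum => B _.
by apply: ler_wpM2l => //; apply: bernoulli_mass_ge0.
Qed.

(** Fubini for a single coordinate: summing out coordinate [i] first turns a
    factor that depends on it alone into its mean. *)
Lemma bexp_coord q i (h : bool -> R) F :
  (forall B, F (i |: B)%SET = F B) ->
  bexp q (fun B => h (i \in B) * F B) =
  (q i * h true + (1 - q i) * h false) * bexp q F.
Proof.
move=> Fi.
pose r B := \prod_(j | j != i) (if j \in B then q j else 1 - q j).
have pair g : bexp q (fun B => g (i \in B) * F B) =
    (q i * g true + (1 - q i) * g false) *
    \sum_(B : {set I} | i \notin B) r B * F B.
  rewrite /bexp (bigID (fun B : {set I} => i \in B)) /=.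
  rewrite (reindex_onto (fun B => i |: B)%SET (fun B => B :\ i)%SET) /=; last first.
    by move=> B iB; rewrite finset.setD1K.
  have subU (B : {set I}) : (i \in i |: B)%SET && ((i |: B) :\ i == B)%SET
      = (i \notin B).
    rewrite finset.setU11 /=; apply/eqP/idP => [<-|]; first by rewrite !inE eqxx.
    exact: finset.setU1K.
  rewrite (eq_bigl _ _ subU) -big_split /= mulr_sumr.
  apply: eq_bigr => B iB; rewrite Fi finset.setU11 (negbTE iB) /bernoulli_mass.
  rewrite (bigD1 i) //= finset.setU11 [X in _ + X * _](bigD1 i) //= (negbTE iB).
  rewrite (eq_bigr (fun j => if j \in B then q j else 1 - q j)); last first.
    by move=> j /negbTE ji; rewrite !inE ji.
  by rewrite -/(r B); ring.
rewrite pair; congr (_ * _).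
have := pair (fun=> 1); rewrite !mulr1 addrC subrK mul1r => <-.
by apply: eq_bexp => B; rewrite mul1r.
Qed.

Definition noise q c B : R := \sum_i c i * ((i \in B)%:R - q i).

(** By induction on the coordinates: the next one and the sum so far are
    centred and independent, so that mixed terms linear in either drop out. *)
Lemma noise_moments_seq q c (r : seq I) : uniq r ->
  let S B := \sum_(i <- r) c i * ((i \in B)%:R - q i) in
  [/\ bexp q S = 0,
      bexp q (fun B => S B ^+ 2) = \sum_(i <- r) c i ^+ 2 * (q i * (1 - q i))
    & prob_vector q -> bexp q (fun B => S B ^+ 4) <=
      3 * (\sum_(i <- r) c i ^+ 2 * (q i * (1 - q i))) ^+ 2
      + \sum_(i <- r) c i ^+ 4 * (q i * (1 - q i))].
Proof.
elim: r => [_|i r IH /= /andP[ir /IH [S1 S2 S4]]] /=.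
  split=> [||q01]; first by under eq_bexp do rewrite big_nil; rewrite bexp_cst.
    by under eq_bexp do rewrite big_nil; rewrite big_nil expr0n bexp_cst.
  by under eq_bexp do rewrite big_nil; rewrite !big_nil !expr0n mulr0 addr0 bexp_cst.
set S := fun B : {set I} => \sum_(j <- r) c j * ((j \in B)%:R - q j).
set v := \sum_(j <- r) c j ^+ 2 * (q j * (1 - q j)) in S2 S4 *.
set u := \sum_(j <- r) c j ^+ 4 * (q j * (1 - q j)) in S4 *.
rewrite -/S in S1 S2 S4.
have Si B : S (i |: B)%SET = S B.
  rewrite /S; apply: eq_big_seq => j jr; rewrite !inE; case: eqP => // ji.
  by rewrite -ji jr in ir.
pose x B : R := (i \in B)%:R - q i.
have mix k l : bexp q (fun B => x B ^+ k * S B ^+ l) =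
    (q i * (1 - q i) ^+ k + (1 - q i) * (- q i) ^+ k) *
    bexp q (fun B => S B ^+ l).
  rewrite (@bexp_coord q i (fun b => (b%:R - q i) ^+ k) (fun B => S B ^+ l)) ?sub0r //.
  by move=> B; rewrite Si.
have E0 : bexp q (fun B => S B ^+ 0) = 1.
  by under eq_bexp do rewrite expr0; rewrite bexp1.
have E1 : bexp q (fun B => S B ^+ 1) = 0.
  by under eq_bexp do rewrite expr1.
split=> [||q01].
- transitivity (bexp q (fun B => c i * (x B ^+ 1 * S B ^+ 0) + S B)).
    by apply: eq_bexp => B; rewrite big_cons expr1 expr0 mulr1.
  by rewrite bexpD bexpZ mix S1; ring.
- rewrite !big_cons -/v -S2.
  transitivity (bexp q (fun B => c i ^+ 2 * (x B ^+ 2 * S B ^+ 0) +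
      ((2 * c i) * (x B ^+ 1 * S B ^+ 1) + S B ^+ 2))).
    by apply: eq_bexp => B; rewrite big_cons -/(S B) /x; ring.
  by rewrite !bexpD !bexpZ !mix E0 E1; ring.
- rewrite !big_cons -/v -/u.
  rewrite (@eq_bexp _ _ (fun B => c i ^+ 4 * (x B ^+ 4 * S B ^+ 0) +
     ((4 * c i ^+ 3) * (x B ^+ 3 * S B ^+ 1) +
     ((6 * c i ^+ 2) * (x B ^+ 2 * S B ^+ 2) +
     ((4 * c i) * (x B ^+ 1 * S B ^+ 3) + S B ^+ 4))))); last first.
    by move=> B; rewrite big_cons -/(S B) /x; ring.
  rewrite !bexpD !bexpZ !mix S2 E0 E1; have /andP[q0 q1] := q01 i.
  have := S4 q01; set E4 := bexp q _ => E4le.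
  set t := q i in q0 q1 *; set E3 := bexp q _.
  have c4 : 0 <= c i ^+ 4 by rewrite (exprM _ 2 2) sqr_ge0.
  have tt : 0 <= t * (1 - t) by rewrite mulr_ge0 // subr_ge0.
  have t4 : t * (1 - t) ^+ 4 + (1 - t) * (- t) ^+ 4 <= t * (1 - t).
    rewrite -subr_ge0; have -> : t * (1 - t) - (t * (1 - t) ^+ 4 + (1 - t) * (- t) ^+ 4)
      = 3 * (t * (1 - t)) ^+ 2 by ring.
    by rewrite mulr_ge0 // sqr_ge0.
  have := ler_wpM2l c4 t4.
  have : 0 <= c i ^+ 4 * (t * (1 - t)) ^+ 2 by rewrite mulr_ge0 // sqr_ge0.
  move=> h1 h2; lra.
Qed.

Lemma bexp_noise q c : bexp q (noise q c) = 0.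
Proof. by have [] := noise_moments_seq q c (index_enum_uniq I). Qed.

Lemma bexp_noise2 q c :
  bexp q (fun B => noise q c B ^+ 2) = \sum_i c i ^+ 2 * (q i * (1 - q i)).
Proof. by have [] := noise_moments_seq q c (index_enum_uniq I). Qed.

(** Only the terms in which every centred coordinate occurs at least twice
    survive in the fourth moment, so that it is governed by the square of the
    variance. *)
Lemma bexp_noise4 q c : prob_vector q ->
  bexp q (fun B => noise q c B ^+ 4) <=
  3 * (\sum_i c i ^+ 2 * (q i * (1 - q i))) ^+ 2
  + \sum_i c i ^+ 4 * (q i * (1 - q i)).
Proof. by have [_ _] := noise_moments_seq q c (index_enum_uniq I); exact. Qed.

End Bernoulli.

(** * Local and global averages on an expander *)

(** Cauchy-Schwarz from the nonnegativity of the sum of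
    [w i * w j * (f i * g j - f j * g i) ^+ 2] over all pairs. *)
Lemma Cauchy_Schwarz_sum (R : realFieldType) (J : finType) (w f g : J -> R) :
  (forall j, 0 <= w j) ->
  (\sum_j w j * (f j * g j)) ^+ 2 <=
  (\sum_j w j * f j ^+ 2) * (\sum_j w j * g j ^+ 2).
Proof.
move=> w0.
have : 0 <= \sum_i \sum_j w i * w j * (f i * g j - f j * g i) ^+ 2.
  by do 2!apply: sumr_ge0 => ? _; rewrite mulr_ge0 ?sqr_ge0 // mulr_ge0.
suff -> : \sum_i \sum_j w i * w j * (f i * g j - f j * g i) ^+ 2 =
    2 * ((\sum_j w j * f j ^+ 2) * (\sum_j w j * g j ^+ 2)
         - (\sum_j w j * (f j * g j)) ^+ 2).
  by rewrite pmulr_rge0 // subr_ge0.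
set F := \sum_j w j * f j ^+ 2; set G := \sum_j w j * g j ^+ 2.
set H := \sum_j w j * (f j * g j).
transitivity (\sum_i (w i * f i ^+ 2 * G + w i * g i ^+ 2 * F
   - 2 * (w i * (f i * g i)) * H)).
  apply: eq_bigr => i _; rewrite !mulr_sumr -big_split /= -sumrN -big_split /=.
  by apply: eq_bigr => j _; ring.
by rewrite sumrB big_split /= -!mulr_suml -mulr_sumr -/F -/G -/H; ring.
Qed.

(** Expected opinion, in the [-1, 1] encoding, of a vertex with opinion [s]
    whose neighbours have average opinion [z]. *)
Definition mean_opinion (R : realFieldType) (m : voting) (s z : R) : R :=
  match m with
  | BestOfTwo => z + s * (1 - z ^+ 2) / 2
  | BestOfThree => (3 * z - z ^+ 3) / 2
  end.

Lemma mean_opinion_bounds (R : realFieldType) m (s z : R) :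
  s ^+ 2 = 1 -> -1 <= z <= 1 -> -1 <= mean_opinion m s z <= 1.
Proof.
move=> s2 /andP[z1 z2].
have z0 : 0 <= 1 - z ^+ 2 by nra.
case: m => /=.
  have /orP[/eqP->|/eqP->] : (s == 1) || (s == -1).
  - by rewrite -eqf_sqr expr1n s2.
  - by apply/andP; split; nra.
  by apply/andP; split; nra.
have h1 : 0 <= (1 - z) ^+ 2 * (2 + z) by rewrite mulr_ge0 ?sqr_ge0 //; lra.
have h2 : 0 <= (1 + z) ^+ 2 * (2 - z) by rewrite mulr_ge0 ?sqr_ge0 //; lra.
apply/andP; split; lra.
Qed.

Section Averages.
Variables (R : realFieldType) (V : finType) (pi : V -> R) (P : V -> V -> R).
Implicit Types (f g : V -> R).

Definition avg f : R := \sum_v pi v * f v.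
Definition walk f (v : V) : R := \sum_u P v u * f u.

(** A reversible random walk with stationary law [pi], all of whose
    eigenvalues but the trivial one are at most [lam] in modulus, and which
    spreads out evenly over [N] vertices up to the constant [c]. The bound on
    [lam] is what the drift estimates can afford. *)
Record expander (N c lam : R) : Prop := Expander {
  expander_c : 0 < c <= 1;
  expander_N : 1 <= c * N;
  expander_lam : 0 <= lam <= 1 / 50;
  expander_pi_ge : forall v, c / N <= pi v;
  expander_pi_le : forall v, pi v <= 1 / (c * N);
  expander_pi_sum : \sum_v pi v = 1;
  expander_P_ge0 : forall v u, 0 <= P v u;
  expander_P_le : forall v u, P v u <= 1 / (c * N);
  expander_P_sum : forall v, \sum_u P v u = 1;
  expander_rev : forall v u, pi v * P v u = pi u * P u v;
  expander_gap : forall f, avg f = 0 ->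
    avg (fun v => walk f v ^+ 2) <= lam ^+ 2 * avg (fun v => f v ^+ 2) }.

Lemma eq_avg f g : f =1 g -> avg f = avg g.
Proof. by move=> fg; apply: eq_bigr => v _; rewrite fg. Qed.

Lemma avgD f g : avg (fun v => f v + g v) = avg f + avg g.
Proof. by rewrite /avg -big_split; apply: eq_bigr => v _; rewrite mulrDr. Qed.

Lemma avgZ a f : avg (fun v => a * f v) = a * avg f.
Proof. by rewrite /avg mulr_sumr; apply: eq_bigr => v _; rewrite mulrCA. Qed.

Lemma walkD f g v : walk (fun v => f v + g v) v = walk f v + walk g v.
Proof. by rewrite /walk -big_split; apply: eq_bigr => u _; rewrite mulrDr. Qed.

Lemma walkZ a f v : walk (fun v => a * f v) v = a * walk f v.
Proof. by rewrite /walk mulr_sumr; apply: eq_bigr => u _; rewrite mulrCA. Qed.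

Variables (N c lam : R).
Hypothesis E : expander N c lam.

Lemma expander_N_gt0 : 0 < N.
Proof.
have [/andP[c0 _] cN _ _ _ _ _ _ _ _ _] := E.
by rewrite -(pmulr_rgt0 _ c0) (lt_le_trans ltr01).
Qed.

Lemma expander_pi_ge0 v : 0 <= pi v.
Proof.
apply: le_trans (expander_pi_ge E v); have [/andP[c0 _] _ _ _ _ _ _ _ _ _ _] := E.
by rewrite divr_ge0 ?ltW // expander_N_gt0.
Qed.

Lemma avg_cst a : avg (fun=> a) = a.
Proof. by rewrite /avg -mulr_suml (expander_pi_sum E) mul1r. Qed.

Lemma walk_cst a v : walk (fun=> a) v = a.
Proof. by rewrite /walk -mulr_suml (expander_P_sum E) mul1r. Qed.

Lemma ler_avg f g : (forall v, f v <= g v) -> avg f <= avg g.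
Proof. by move=> fg; apply: ler_sum => v _; rewrite ler_wpM2l ?expander_pi_ge0. Qed.

Lemma avg_ge0 f : (forall v, 0 <= f v) -> 0 <= avg f.
Proof. by move=> f0; apply: sumr_ge0 => v _; rewrite mulr_ge0 ?expander_pi_ge0. Qed.

Lemma avg_walk f : avg (walk f) = avg f.
Proof.
rewrite /avg /walk; under eq_bigr do rewrite mulr_sumr.
rewrite exchange_big; apply: eq_bigr => u _ /=.
under eq_bigr do rewrite mulrA (expander_rev E).
by rewrite -mulr_suml -mulr_sumr (expander_P_sum E) mulr1.
Qed.

Lemma avg_CS f g :
  avg (fun v => f v * g v) ^+ 2 <=
  avg (fun v => f v ^+ 2) * avg (fun v => g v ^+ 2).
Proof. by apply: Cauchy_Schwarz_sum; exact: expander_pi_ge0. Qed.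

Lemma avg_centered_sqr f a :
  avg (fun v => (f v - a) ^+ 2) =
  avg (fun v => (f v - avg f) ^+ 2) + (avg f - a) ^+ 2.
Proof.
pose k t := avg (fun v => f v ^+ 2) - 2 * t * avg f + t ^+ 2.
have kE t : avg (fun v => (f v - t) ^+ 2) = k t.
  rewrite /k -(avg_cst (t ^+ 2)) -mulNr -avgZ -!avgD.
  by apply: eq_avg => v; ring.
by rewrite !kE /k; ring.
Qed.

Lemma avg_sqr f :
  avg (fun v => f v ^+ 2) = avg (fun v => (f v - avg f) ^+ 2) + avg f ^+ 2.
Proof.
have := avg_centered_sqr f 0; rewrite subr0 => <-.
by apply: eq_avg => v; rewrite subr0.
Qed.

Lemma avg_centered_le f a :
  avg (fun v => (f v - avg f) ^+ 2) <= avg (fun v => (f v - a) ^+ 2).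
Proof. by rewrite (avg_centered_sqr f a) lerDl sqr_ge0. Qed.

Lemma avg_sqr_le f : avg f ^+ 2 <= avg (fun v => f v ^+ 2).
Proof.
by rewrite avg_sqr lerDr avg_ge0 // => v; rewrite sqr_ge0.
Qed.

Section OneState.
Variable s : V -> R.
Hypothesis s2 : forall v, s v ^+ 2 = 1.

Let z := walk s.
Let delta := avg s.
Let y v := z v - delta.
Let w := avg (fun v => y v ^+ 2).

Lemma sbound v : -1 <= s v <= 1.
Proof. by have := s2 v => h; apply/andP; split; nra. Qed.

Lemma avg_bound f : (forall v, -1 <= f v <= 1) -> -1 <= avg f <= 1.
Proof.
move=> fb; apply/andP; split.
  by rewrite -(avg_cst (-1)) ler_avg // => v; have /andP[] := fb v.
by rewrite -[leRHS](avg_cst 1) ler_avg // => v; have /andP[] := fb v.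
Qed.

Lemma walk_bound f v : (forall v, -1 <= f v <= 1) -> -1 <= walk f v <= 1.
Proof.
move=> fb; apply/andP; split.
  rewrite -(walk_cst (-1) v); apply: ler_sum => u _.
  by rewrite ler_wpM2l ?(expander_P_ge0 E) //; have /andP[] := fb u.
rewrite -[leRHS](walk_cst 1 v); apply: ler_sum => u _.
by rewrite ler_wpM2l ?(expander_P_ge0 E) //; have /andP[] := fb u.
Qed.

Lemma zbound v : -1 <= z v <= 1.
Proof. exact/walk_bound/sbound. Qed.

Lemma dbound : -1 <= delta <= 1.
Proof. exact/avg_bound/sbound. Qed.

Lemma avg_y : avg y = 0.
Proof.
rewrite (@eq_avg y (fun v => z v + - delta)) // avgD avg_cst avg_walk.
by rewrite subrr.
Qed.

Lemma avg_s_centered : avg (fun v => s v - delta) = 0.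
Proof. by rewrite avgD avg_cst subrr. Qed.

Lemma walk_s_centered v : walk (fun v => s v - delta) v = y v.
Proof. by rewrite walkD walk_cst. Qed.

Lemma opinion_variance : avg (fun v => (s v - delta) ^+ 2) = 1 - delta ^+ 2.
Proof.
have := avg_sqr s; rewrite (eq_avg s2) avg_cst -/delta => ->; ring.
Qed.

Lemma unevenness_ge0 : 0 <= w.
Proof. by apply: avg_ge0 => v; rewrite sqr_ge0. Qed.

Lemma unevenness_le : w <= lam ^+ 2 * (1 - delta ^+ 2).
Proof.
rewrite -opinion_variance; apply: le_trans (expander_gap E avg_s_centered).
by apply: ler_avg => v; rewrite walk_s_centered.
Qed.

Variable m : voting.
Let e v := mean_opinion m (s v) (z v).
Let mu := avg e.

Lemma ebound v : -1 <= e v <= 1.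
Proof. exact/mean_opinion_bounds/zbound. Qed.

(** Replacing every local average by the global one turns the mean opinion
    into [(3 * delta - delta ^+ 3) / 2] for both rules; what is lost is
    controlled by the spectral gap and the unevenness. *)
Lemma bias_drift : exists2 rho,
  mu = (3 * delta - delta ^+ 3 - rho) / 2 &
  `|rho| <= 3 * lam * `|delta| * (1 - delta ^+ 2) + 2 * w.
Proof.
have [/andP[l0 l1]] := expander_lam E.
have /andP[d1 d2] := dbound.
have w0 := unevenness_ge0; have wl := unevenness_le.
have vd : 0 <= 1 - delta ^+ 2 by nra.
have abs_d : 0 <= `|delta| by [].
have ww : w <= lam * (1 - delta ^+ 2).
  apply: le_trans wl _; rewrite ler_wpM2r // expr2 ler_piMl //; lra.
have y2 v : -2 <= y v <= 2.
  by have /andP[? ?] := zbound v; rewrite /y; apply/andP; split; lra.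
case em: m.
  (* [sy] correlates the opinion of a vertex with that of its neighbours *)
  pose sy := avg (fun v => s v * y v); pose syy := avg (fun v => s v * y v ^+ 2).
  exists (2 * delta * sy + syy).
    rewrite /mu /sy /syy.
    transitivity (avg (fun v => z v + (1/2) * s v
       + (- (1/2) * delta ^+ 2) * s v + (- delta) * (s v * y v)
       + (- (1/2)) * (s v * y v ^+ 2))).
      by apply: eq_avg => v; rewrite /e em /= /y; field.
    by rewrite !avgD !avgZ avg_walk -/delta; field.
  have sy_le : `|sy| <= lam * (1 - delta ^+ 2).
    have -> : sy = avg (fun v => (s v - delta) * y v).
      transitivity (avg (fun v => (s v - delta) * y v + delta * y v)).
        by apply: eq_avg => v; ring.
      by rewrite avgD avgZ avg_y mulr0 addr0.
    rewrite -ler_sqr ?nnegrE // ?mulr_ge0 // real_normK ?num_real //.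
    apply: le_trans (avg_CS _ _) _; rewrite opinion_variance -/w.
    rewrite (_ : (lam * _) ^+ 2 = (1 - delta ^+ 2) * (lam ^+ 2 * (1 - delta ^+ 2))).
      by rewrite ler_wpM2l.
    by ring.
  have syy_le : `|syy| <= w.
    rewrite ler_norml; apply/andP; split.
      rewrite /w -mulN1r -avgZ; apply: ler_avg => v.
      by have /andP[? ?] := sbound v; have := sqr_ge0 (y v); nra.
    apply: ler_avg => v.
    by have /andP[? ?] := sbound v; have := sqr_ge0 (y v); nra.
  apply: le_trans (ler_normD _ _) _; rewrite !normrM [`|2|]ger0_norm //.
  have : 2 * `|delta| * `|sy| <= 2 * `|delta| * (lam * (1 - delta ^+ 2)).
    by rewrite ler_wpM2l // mulr_ge0.
  have : 0 <= `|delta| * (lam * (1 - delta ^+ 2)) by rewrite !mulr_ge0.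
  move=> h1 h2; lra.
exists (3 * delta * w + avg (fun v => y v ^+ 3)).
  rewrite /mu /w.
  transitivity (avg (fun v => (- (1/2) * delta ^+ 3) + (3/2) * z v
     + (- (3/2) * delta ^+ 2) * y v + (- (3/2) * delta) * (y v ^+ 2)
     + (- (1/2)) * (y v ^+ 3))).
    by apply: eq_avg => v; rewrite /e em /= /y; field.
  by rewrite !avgD !avgZ avg_walk avg_y avg_cst -/delta; field.
have y3 : `|avg (fun v => y v ^+ 3)| <= 2 * w.
  rewrite ler_norml /w -mulNr -!avgZ; apply/andP; split; apply: ler_avg => v;
    have /andP[? ?] := y2 v; have := sqr_ge0 (y v); rewrite exprS => ?; nra.
apply: le_trans (ler_normD _ _) _; rewrite !normrM [`|3|]ger0_norm // (ger0_norm w0).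
have : 3 * `|delta| * w <= 3 * `|delta| * (lam * (1 - delta ^+ 2)).
  by rewrite ler_wpM2l // mulr_ge0.
move=> h; lra.
Qed.

(** Averaging over neighbours damps everything but the global mean. For
    best-of-two the inertia of the own opinion only lets one half of [y]
    survive. *)
Lemma unevenness_drift :
  avg (fun v => (walk e v - mu) ^+ 2) <= 3 / 4 * w.
Proof.
have [/andP[l0 l1]] := expander_lam E.
have /andP[d1 d2] := dbound.
have w0 := unevenness_ge0.
have l2 : lam ^+ 2 <= 1 / 32 by nra.
have walk_e v : walk e v - mu = walk (fun v => e v - mu) v.
  by rewrite walkD walk_cst.
have e0 : avg (fun v => e v - mu) = 0 by rewrite avgD avg_cst subrr.
case em: m.
  pose t v := s v * (z v ^+ 2 - delta ^+ 2).
  pose g v := y v - (1/2) * (t v - avg t).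
  have eg v : e v - mu = g v + ((1 - delta ^+ 2) / 2) * (s v - delta).
    have -> : mu = delta + (1 - delta ^+ 2) / 2 * delta - (1/2) * avg t.
      rewrite /mu.
      transitivity (avg (fun v => z v + ((1 - delta ^+ 2) / 2) * s v
          + (- (1/2)) * t v)).
        by apply: eq_avg => u; rewrite /e em /= /t; field.
      by rewrite !avgD !avgZ avg_walk -/delta; ring.
    by rewrite /e em /g /y /= /t; field.
  have g0 : avg g = 0.
    transitivity (avg (fun v => y v + ((- (1/2)) * t v + (1/2) * avg t))).
      by apply: eq_avg => v; rewrite /g; ring.
    by rewrite avgD avg_y avgD avgZ avg_cst; ring.
  have g2 : avg (fun v => g v ^+ 2) <= 4 * w.
    apply: (@le_trans _ _ (2 * w + (1/2) * avg (fun v => (t v - avg t) ^+ 2))).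
      rewrite /w -!avgZ -avgD; apply: ler_avg => v; rewrite /g.
      have := sqr_ge0 (y v + (1/2) * (t v - avg t)); move: (y v) (t v - _) => a b h.
      lra.
    have := avg_centered_le t 0.
    have : avg (fun v => (t v - 0) ^+ 2) <= 4 * w.
      rewrite /w -avgZ; apply: ler_avg => v; rewrite subr0 /t exprMn s2 mul1r.
      have /andP[z1 z2] := zbound v.
      rewrite (_ : (_ - _) ^+ 2 = (z v + delta) ^+ 2 * y v ^+ 2); last first.
        by rewrite /y; ring.
      apply: ler_wpM2r; first exact: sqr_ge0.
      by nra.
    move=> h1 h2; lra.
  have := expander_gap E g0; set W := avg _ => Wg.
  have : avg (fun v => (walk e v - mu) ^+ 2) <=
      2 * W + (1/2) * w.
    rewrite /W /w -!avgZ -avgD; apply: ler_avg => v.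
    have -> : walk e v - mu = walk g v + ((1 - delta ^+ 2) / 2) * y v.
      rewrite walk_e -walk_s_centered -walkZ -walkD.
      by apply: eq_bigr => u _; rewrite eg.
    set a := walk g v; set b := y v; set k := (1 - delta ^+ 2) / 2.
    have k1 : 0 <= k by rewrite /k; nra.
    have k2 : k <= 1/2 by rewrite /k; have := sqr_ge0 delta; lra.
    have kk : k ^+ 2 <= 1/4 by nra.
    have h1 := sqr_ge0 (a - k * b).
    have h2 : k ^+ 2 * b ^+ 2 <= (1/4) * b ^+ 2 by rewrite ler_wpM2r ?sqr_ge0.
    lra.
  have : lam ^+ 2 * avg (fun v => g v ^+ 2) <= 1/32 * (4 * w).
    by apply: ler_pM => //; rewrite ?sqr_ge0 // avg_ge0 // => v; rewrite sqr_ge0.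
  move=> h1 h2; lra.
rewrite (@eq_avg _ (fun v => walk (fun v => e v - mu) v ^+ 2)); last first.
  by move=> v; rewrite walk_e.
apply: le_trans (expander_gap E e0) _.
have : avg (fun v => (e v - mu) ^+ 2) <= 9 / 4 * w.
  apply: le_trans (avg_centered_le _ ((3 * delta - delta ^+ 3) / 2)) _.
  rewrite /w -[leRHS]avgZ; apply: ler_avg => v; have /andP[z1 z2] := zbound v.
  rewrite (_ : e v - _ = ((3 - (z v ^+ 2 + z v * delta + delta ^+ 2)) / 2) * y v);
    last by rewrite /e em /y /=; field.
  rewrite exprMn; apply: ler_wpM2r; first exact: sqr_ge0.
  have q1 : 0 <= z v ^+ 2 + z v * delta + delta ^+ 2.
    by have := sqr_ge0 (z v + delta / 2); have := sqr_ge0 delta; nra.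
  have q2 : z v ^+ 2 + z v * delta + delta ^+ 2 <= 3 by nra.
  by move: q1 q2; move: (_ + _ + _) => q q1 q2; nra.
move=> h.
have : lam ^+ 2 * avg (fun v => (e v - mu) ^+ 2) <= 1/32 * (9 / 4 * w).
  by apply: ler_pM => //; rewrite ?sqr_ge0 // avg_ge0 // => v; rewrite sqr_ge0.
move=> h1; lra.
Qed.

Lemma mean_opinion_var_le : avg (fun v => 1 - e v ^+ 2) <= 1 - mu ^+ 2.
Proof.
rewrite avgD avg_cst lerD2l (@eq_avg _ (fun v => (-1) * e v ^+ 2)).
  by rewrite avgZ mulN1r lerN2 avg_sqr_le.
by move=> v; rewrite mulN1r.
Qed.

(** Close to balance nobody is sure of the next opinion, so that the noise of
    a step has its full strength. *)
Lemma mean_opinion_var_ge : delta ^+ 2 <= 1 / 64 -> w <= 1 / 64 ->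
  1 / 4 <= avg (fun v => 1 - e v ^+ 2).
Proof.
move=> d64 w64.
have zz : avg (fun v => z v ^+ 2) = w + delta ^+ 2.
  by rewrite avg_sqr avg_walk.
apply: (@le_trans _ _ (avg (fun v => 1 / 2 + (- 8) * z v ^+ 2))).
  by rewrite avgD avg_cst avgZ zz; lra.
apply: ler_avg => v; have /andP[z1 z2] := zbound v; have := s2 v.
rewrite /e; case em: m => /= ss.
  set t := s v in ss *; set x := z v in z1 z2 *.
  have h : (t * (1 - x ^+ 2) / 2) ^+ 2 = (1 - x ^+ 2) ^+ 2 / 4.
    by rewrite !exprMn ss; field.
  have h2 : (1 - x ^+ 2) ^+ 2 <= 1.
    by rewrite expr_le1 //; have := sqr_ge0 x; nra.
  have h3 := sqr_ge0 (x - t * (1 - x ^+ 2) / 2).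
  have h4 : (x + t * (1 - x ^+ 2) / 2) ^+ 2 <= 2 * x ^+ 2 + 2 * ((1 - x ^+ 2) ^+ 2 / 4).
    by rewrite -h; lra.
  have := sqr_ge0 x; lra.
set x := z v in z1 z2 *.
have -> : ((3 * x - x ^+ 3) / 2) ^+ 2 = x ^+ 2 * ((3 - x ^+ 2) / 2) ^+ 2 by field.
have x2 : 0 <= x ^+ 2 <= 1 by apply/andP; split; nra.
move: (x ^+ 2) x2 => q /andP[q0 q1]; nra.
Qed.

End OneState.
End Averages.

(** * Drift of the bias and decay of the potential *)

Section Arithmetic.
Variable R : realFieldType.
Implicit Types (c nu K : R).

Lemma inv_second_order (k b x : R) : 0 < k -> 0 <= b -> 0 <= x ->
  1 / (k + x) <= 1 / (k + b) - (x - b) / (k + b) ^+ 2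
                 + (x - b) ^+ 2 / (k * (k + b) ^+ 2).
Proof.
move=> k0 b0 x0.
have kb : k + b != 0 by rewrite gt_eqF // ltr_pwDl.
have kx : k + x != 0 by rewrite gt_eqF // ltr_pwDl.
have kn : k != 0 by rewrite gt_eqF.
rewrite -subr_ge0.
have -> : 1 / (k + b) - (x - b) / (k + b) ^+ 2 + (x - b) ^+ 2 / (k * (k + b) ^+ 2)
   - 1 / (k + x) = x * (x - b) ^+ 2 / (k * (k + b) ^+ 2 * (k + x)).
  by field; rewrite kb kx kn.
apply: divr_ge0; first by apply: mulr_ge0; rewrite ?sqr_ge0.
apply: mulr_ge0; last by rewrite addr_ge0 // ltW.
by apply: mulr_ge0; rewrite ?sqr_ge0 // ltW.
Qed.

Variables (lam delta w rho t : R).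
Hypotheses (lam01 : 0 <= lam <= 1 / 50) (delta1 : -1 <= delta <= 1).
Hypotheses (w0 : 0 <= w) (wl : w <= lam ^+ 2 * (1 - delta ^+ 2)).
Hypothesis rho_le : `|rho| <= 3 * lam * `|delta| * (1 - delta ^+ 2) + 2 * w.
Hypothesis wt : w ^+ 2 <= t.
Let mu := (3 * delta - delta ^+ 3 - rho) / 2.

(** The bias grows by a factor bounded away from one as long as it is neither
    tiny nor close to one; the deficit [t] only matters for tiny biases. *)
Lemma bias_growth :
  delta ^+ 2 + delta ^+ 2 * (1 - delta ^+ 2) / 2 - 36 * t * (1 - delta ^+ 2)
  <= mu ^+ 2.
Proof.
have /andP[l0 l1] := lam01; have /andP[d1 d2] := delta1.
have u0 : 0 <= 1 - delta ^+ 2 by nra.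
have dd : 0 <= delta ^+ 2 := sqr_ge0 _.
have a0 : 0 <= `|delta| by [].
have a2 : `|delta| ^+ 2 = delta ^+ 2 by rewrite real_normK ?num_real.
have a1 : `|delta| <= 1 by rewrite ler_norml.
have t0 : 0 <= t := le_trans (sqr_ge0 _) wt.
have l2 : lam ^+ 2 <= 1 / 2500 by nra.
pose m0 := (3 * delta - delta ^+ 3) / 2.
have m0E : m0 ^+ 2 = delta ^+ 2 * (3 - delta ^+ 2) ^+ 2 / 4 by rewrite /m0; field.
have m0le : `|m0| <= 3 / 2 * `|delta|.
  rewrite (_ : m0 = delta * ((3 - delta ^+ 2) / 2)) /m0; last by field.
  by rewrite normrM mulrC ler_wpM2r // ger0_norm; nra.
have step : m0 ^+ 2 - `|m0| * `|rho| <= mu ^+ 2.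
  have -> : mu = m0 - rho / 2 by rewrite /mu /m0; field.
  rewrite sqrrB -normrM; have := ler_norm (m0 * rho); have := sqr_ge0 (rho / 2).
  by move=> h1 h2; rewrite -mulr_natr; lra.
have prod : `|m0| * `|rho| <=
    3 / 2 * `|delta| * (3 * lam * `|delta| * (1 - delta ^+ 2) + 2 * w).
  exact: ler_pM.
have cross : 3 * `|delta| * w <=
    (1 / 4 + 6 * lam ^+ 2) * (delta ^+ 2 * (1 - delta ^+ 2)) + 36 * t * (1 - delta ^+ 2).
  have dl : 0 <= lam ^+ 2 * (delta ^+ 2 * (1 - delta ^+ 2)).
    by rewrite (mulr_ge0 (sqr_ge0 _)) // mulr_ge0.
  have dv : 0 <= delta ^+ 2 * (1 - delta ^+ 2) by rewrite mulr_ge0.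
  have [hd|hd] := lerP (delta ^+ 2) (1/2).
    have h := sqr_ge0 (`|delta| - 12 * w).
    have h1 : t <= 2 * (t * (1 - delta ^+ 2)) by nra.
    have h2 : delta ^+ 2 <= 2 * (delta ^+ 2 * (1 - delta ^+ 2)) by nra.
    move: a2 h wt h1 h2 dl; move: `|delta| => a *; lra.
  have h1 : `|delta| * w <= 2 * delta ^+ 2 * (lam ^+ 2 * (1 - delta ^+ 2)).
    apply: ler_pM => //; nra.
  have h2 : 0 <= t * (1 - delta ^+ 2) by rewrite mulr_ge0.
  lra.
have q1 : delta ^+ 2 + delta ^+ 2 * (1 - delta ^+ 2) <= m0 ^+ 2.
  rewrite m0E; move: (delta ^+ 2) u0 dd => D u0 dd.
  have := mulr_ge0 (mulr_ge0 dd u0) u0; lra.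
have q2 : (9 / 2 * lam + 6 * lam ^+ 2) * (delta ^+ 2 * (1 - delta ^+ 2)) <=
          1 / 4 * (delta ^+ 2 * (1 - delta ^+ 2)).
  by apply: ler_wpM2r; [rewrite mulr_ge0 | lra].
have e1 : 3 / 2 * `|delta| * (3 * lam * `|delta| * (1 - delta ^+ 2) + 2 * w) =
   9 / 2 * lam * (delta ^+ 2 * (1 - delta ^+ 2)) + 3 * `|delta| * w.
  by rewrite -a2; field.
lra.
Qed.

Lemma bias_growth_le : mu ^+ 2 <= 8 * delta ^+ 2 + 2 * t.
Proof.
have /andP[l0 l1] := lam01; have /andP[d1 d2] := delta1.
have u0 : 0 <= 1 - delta ^+ 2 by nra.
have a0 : 0 <= `|delta| by [].
have a2 : `|delta| ^+ 2 = delta ^+ 2 by rewrite real_normK ?num_real.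
have mule : `|mu| <= 2 * `|delta| + w.
  rewrite /mu normrM [`|2^-1|]ger0_norm ?invr_ge0 // ler_pdivrMr //.
  apply: le_trans (ler_normB _ _) _.
  have h : `|3 * delta - delta ^+ 3| <= 3 * `|delta|.
    rewrite (_ : _ - _ = delta * (3 - delta ^+ 2)); last by ring.
    by rewrite normrM mulrC ler_wpM2r // ger0_norm; nra.
  have h1 : lam * `|delta| * (1 - delta ^+ 2) <= 1 / 50 * `|delta|.
    apply: (@le_trans _ _ (lam * `|delta|)); last by rewrite ler_wpM2r.
    rewrite ler_piMr ?mulr_ge0 //; have := sqr_ge0 delta; lra.
  move: rho_le h h1 a0; move: `|delta| `|rho| `|_ - _| => a b e *; lra.
have : `|mu| ^+ 2 <= (2 * `|delta| + w) ^+ 2 by rewrite ler_sqr ?nnegrE ?addr_ge0 ?mulr_ge0.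
rewrite real_normK ?num_real // => h.
have := sqr_ge0 (2 * `|delta| - w).
move: a2 h wt; move: `|delta| => a *; lra.
Qed.

End Arithmetic.

Section Potential.
Variable R : realFieldType.

(** Constants, as functions of the evenness constant of the graph: the
    regularisation of the potential, its decay rate, and the threshold for
    the squared unevenness. The regularisation is large enough to beat the
    Taylor remainder of the potential, and the rate is small in terms of it. *)
Definition reg (c : R) := (28 * 1024) / c ^+ 3.
Definition rate (c : R) := c / (1300 * reg c).
Definition even_tol (c : R) := c / 100 / 100.

Lemma reg_ge (c : R) : 0 < c <= 1 -> 28 * 1024 <= reg c.
Proof.
move=> /andP[c0 c1]; have c3 : 0 < c ^+ 3 by rewrite exprn_gt0.
have : c ^+ 3 <= 1 by apply: exprn_ile1 => //; exact: ltW.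
by rewrite /reg (ler_pdivlMr _ _ c3); lra.
Qed.

Lemma reg_gt0 (c : R) : 0 < c <= 1 -> 0 < reg c.
Proof. by move=> /reg_ge; lra. Qed.

Lemma rate_range (c : R) : 0 < c <= 1 -> 0 < rate c <= 1 / 4.
Proof.
move=> c01; have K1 := reg_ge c01; have /andP[c0 c1] := c01.
have rK : 0 < 1300 * reg c by lra.
by rewrite /rate (divr_gt0 c0 rK) /= (ler_pdivrMr _ _ rK); lra.
Qed.

(** Near balance the drift can fall short by [t], but the noise, represented
    by [2000 * t], outweighs this. *)
Lemma noise_regime (k t d M e : R) :
  0 <= d <= 1 -> 0 < t -> 72 * t <= k -> 0 <= M ->
  d + d * (1 - d) / 2 - 36 * t * (1 - d) <= M -> M <= 8 * d + 2 * t ->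
  0 <= e <= 1 / 2000 -> e * k <= 8 * t ->
  e * (k + M) ^+ 2 <=
  (d / 2 - 36 * t) * (k + M) + (2000 * t - M / 1024) * (k + d).
Proof.
move=> /andP[d0 d1] t0 kt M0 Mlo Mhi /andP[e0 e1] ek.
have k0 : 0 < k by lra.
have hg : k + d <= 2 * (k + M).
  have : t * (1 - d) <= t by rewrite ler_piMr // ?(ltW t0) //; lra.
  have : 0 <= d * (1 - d) by rewrite mulr_ge0 // subr_ge0.
  by move=> h1 h2; lra.
have gh : k + M <= 9 * (k + d) by lra.
have eg : e * (k + d) <= 8 * t + 1 / 2000 * d.
  by rewrite mulrDr lerD // ler_wpM2r.
have h0 : 0 < k + M by rewrite ltr_pwDl.
have g0 : 0 < k + d by rewrite ltr_pwDl.
move: (k + M) (k + d) hg gh eg h0 g0 {Mlo kt ek} => h g hg gh eg h0 g0.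
have p1 := ler_wpM2l d0 hg.
have p2 := ler_wpM2l (ltW t0) gh.
have p3 : e * h ^+ 2 <= 81 * (e * g * g).
  have : h ^+ 2 <= (9 * g) ^+ 2 by rewrite ler_sqr ?nnegrE ?mulr_ge0 // ltW.
  move=> /(ler_wpM2l e0); move: (h ^+ 2) => *; lra.
have p4 := ler_wpM2r (ltW g0) eg.
have p5 := ler_wpM2r (ltW g0) Mhi.
have tg : 0 <= t * g := mulr_ge0 (ltW t0) (ltW g0).
have dg : 0 <= d * g := mulr_ge0 d0 (ltW g0).
apply: le_trans p3 _; lra.
Qed.

(** Away from balance the drift alone pays for the decay and for the Taylor
    remainder, represented by the last term. *)
Lemma drift_regime (k t d M e : R) :
  1 / 64 <= d <= 1 -> 0 <= t <= 1 / 100 / 100 -> 0 < k <= 1 -> 0 <= M <= 1 ->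
  d + d * (1 - d) / 2 - 36 * t * (1 - d) <= M -> 0 <= e <= 1 / 2000 ->
  e * (1 - d) * (k + M) ^+ 2 <=
  (M - d) * (k + M) - (1 - d) / 512 * (k + d).
Proof.
move=> /andP[d0 d1] /andP[t0 t1] /andP[k0 k1] /andP[M0 M1] Mlo /andP[e0 e1].
have u0 : 0 <= 1 - d by rewrite subr_ge0.
have gain : (1 - d) / 256 <= M - d.
  have h1 : (1 - d) * (1 / 128) <= (1 - d) * (d / 2) by rewrite ler_wpM2l //; lra.
  have h2 := ler_wpM2r u0 t1.
  lra.
have gh : k + d <= k + M by lra.
have h2 : k + M <= 2 by lra.
have h0 : 0 < k + M by rewrite ltr_pwDl.
move: (k + M) (k + d) (1 - d) u0 gain gh h2 h0 {Mlo} => h g u u0 gain gh h2 h0.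
have m1 := ler_wpM2r (ltW h0) gain.
have m2 := ler_wpM2l u0 gh.
have m3 : e * h <= 1 / 1000 by have := ler_pM e0 (ltW h0) e1 h2; lra.
have m4 := ler_wpM2l (mulr_ge0 u0 (ltW h0)) m3.
have m5 := mulr_ge0 u0 (ltW h0).
move: m1 m2 m4 m5; clear; move: (M - d) => x *; lra.
Qed.

(** With [d] the squared bias, [M] the squared mean of the next bias and [v]
    its variance, the right side measures the expected decay of
    [1 / (k + d)], and the left side is what has to be achieved. *)
Lemma potential_balance (c nu d M v E4 : R) (k := reg c * nu)
    (t := even_tol c * nu) :
  0 < c <= 1 -> 0 < nu <= c -> k <= 1 -> 0 <= d <= 1 -> 0 <= M <= 1 ->
  d + d * (1 - d) / 2 - 36 * t * (1 - d) <= M -> M <= 8 * d + 2 * t ->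
  0 <= v <= nu / c * (1 - M) ->
  (d <= 1 / 64 -> c * nu / 4 <= v) ->
  E4 <= 3 * v ^+ 2 + 4 * (nu / c) ^+ 2 * v ->
  rate c * (1 - d) * (k + M) ^+ 2 <=
  (M - d) * (k + M) + (v - (8 * M * v + 2 * E4) / k) * (k + d).
Proof.
move=> /andP[c0 c1] /andP[n0 nc] k1 /andP[d0 d1] /andP[M0 M1] Mlo Mhi
  /andP[v0 vhi] vlo E4hi.
set u := 1 - d; have u0 : 0 <= u by rewrite subr_ge0.
set b := nu / c in vhi E4hi.
have b0 : 0 < b by rewrite divr_gt0.
have b1 : b <= 1 by rewrite ler_pdivrMr // mul1r.
have nE : nu = b * c by rewrite /b divfK // gt_eqF.
have K0 := reg_ge (introT andP (conj c0 c1)).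
have K1 : 0 < reg c by lra.
have k0 : 0 < k by rewrite mulr_gt0 // K1.
have n1 : nu <= 1 by exact: le_trans nc c1.
have t_le : t <= nu / 100 / 100.
  have : c * nu <= nu by rewrite ler_piMl // ltW.
  by rewrite /t /even_tol; lra.
have t0 : 0 < t by rewrite /t /even_tol mulr_gt0 // !divr_gt0.
have cn : c * nu = (100 * 100) * t by rewrite /t /even_tol; field.
have v2u : v <= 2 * u * b.
  apply: le_trans vhi _; rewrite mulrC ler_wpM2r ?(ltW b0) //.
  have : 36 * t * u <= u by rewrite ler_piMl //; lra.
  have : 0 <= d * u / 2 by rewrite divr_ge0 ?mulr_ge0.
  rewrite -/u in Mlo; rewrite /u in Mlo *; lra.
have vb : v <= b by apply: le_trans vhi _; rewrite ler_piMr ?(ltW b0) //; lra.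
have E4u : E4 <= 14 * u * b ^+ 2.
  apply: le_trans E4hi _.
  have h1 : v ^+ 2 <= 2 * u * b * b by rewrite expr2 ler_pM.
  have h2 : b ^+ 2 * v <= b ^+ 2 * (2 * u).
    rewrite ler_wpM2l ?sqr_ge0 //; apply: le_trans v2u _.
    by rewrite ler_piMr // mulr_ge0.
  lra.
have Vle : (8 * M * v + 2 * E4) / k <= c / 1024 * u * (M + nu).
  rewrite ler_pdivrMr // /k /reg.
  have h1 : M * v <= M * (2 * u * b) by rewrite ler_wpM2l.
  have -> : c / 1024 * u * (M + nu) * ((28 * 1024) / c ^+ 3 * nu) =
     28 * u * (M * b / c + b ^+ 2).
    by rewrite nE; field; rewrite gt_eqF.
  have h2 : M * b <= M * b / c.
    by rewrite ler_pdivlMr // ler_piMr // mulr_ge0 // ltW.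
  have h3 := ler_wpM2l u0 h2.
  have h4 : 0 <= u * (M * b) := mulr_ge0 u0 (mulr_ge0 M0 (ltW b0)).
  lra.
have e0 : rate c * reg c = c / 1300.
  by rewrite /rate; field; rewrite gt_eqF // K1.
have rK : 0 < 1300 * reg c by lra.
have e1 : rate c <= 1 / 1300 / 28 / 1024.
  by rewrite /rate (ler_pdivrMr _ _ rK); lra.
have /andP[/ltW e2 _] := rate_range (introT andP (conj c0 c1)).
have ek : rate c * k = (100 * 100) / 1300 * t.
  by rewrite /k mulrA e0 /t /even_tol; field.
set h := k + M; set g := k + d.
have h0 : 0 < h by rewrite ltr_pwDl.
have g0 : 0 < g by rewrite ltr_pwDl.
apply: (@le_trans _ _ ((M - d) * h + (v - c / 1024 * u * (M + nu)) * g)); last first.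
  by rewrite lerD2l ler_wpM2r ?(ltW g0) // lerD2l lerN2.
have [hd|hd] := lerP d (1 / 64).
  have {}vlo := vlo hd.
  have kt : 72 * t <= k.
    apply: (@le_trans _ _ (28 * 1024 * nu)); last by rewrite ler_wpM2r // ltW.
    by move: t_le n0; clear; move=> *; lra.
  have := @noise_regime k t d M (rate c).
  rewrite d0 d1 e2 -/h -/g => /(_ isT t0 kt M0 Mlo Mhi).
  have -> : rate c <= 1 / 2000 by apply: le_trans e1 _; clear; lra.
  have -> : rate c * k <= 8 * t by rewrite ek; move: t0; clear; move=> *; lra.
  move=> /(_ isT isT) /(ler_wpM2l u0) main.
  have m1 : u * (d / 2 - 36 * t) * h <= (M - d) * h.
    rewrite ler_wpM2r ?(ltW h0) //; move: Mlo; rewrite -/u; clear; move=> *; lra.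
  have m2 : u * (50 * 50 * t) * g <= v * g.
    rewrite ler_wpM2r ?(ltW g0) //; apply: le_trans vlo.
    rewrite cn; have : u * t <= t by rewrite ler_piMl ?(ltW t0) // /u lerBlDr lerDl.
    clear; move=> *; lra.
  have m3 : c * M <= M by rewrite ler_piMl.
  have m4 := ler_wpM2r (ltW g0) (ler_wpM2l u0 m3).
  have m5 := mulr_ge0 u0 (mulr_ge0 (ltW t0) (ltW g0)).
  have m6 : u * (c * nu) * g = (100 * 100) * (u * (t * g)) by rewrite cn; ring.
  have -> : c / 1024 * u * (M + nu) =
    (u * (c * M) + u * (c * nu)) / 1024 by field.
  move: main m1 m2 m4 m5 m6; clear.
  move: (M - d) (d / 2 - 36 * t) (rate c) (c * M) (c * nu) => x1 x2 x3 x4 x5 *.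
  lra.
have := @drift_regime k t d M (rate c).
rewrite (ltW hd) d1 k0 k1 M0 M1 e2 (ltW t0) -/h -/g => /(_ isT).
have -> : t <= 1 / 100 / 100 by move: t_le n1; clear; move=> *; lra.
have -> : rate c <= 1 / 2000 by apply: le_trans e1 _; clear; lra.
move=> /(_ isT isT isT Mlo isT) main; apply: le_trans main _.
have m1 : 0 <= v * g := mulr_ge0 v0 (ltW g0).
have m2 : c * (M + nu) <= 1 * 2.
  by apply: ler_pM; rewrite ?(ltW c0) ?addr_ge0 ?(ltW n0) // lerD.
have m3 := ler_wpM2r (ltW g0) (ler_wpM2l u0 m2).
have -> : c / 1024 * u * (M + nu) = u * (c * (M + nu)) / 1024 by field.
move: m1 m3; rewrite /u; clear; move: (c * (M + nu)) => x *; lra.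
Qed.

End Potential.

(** * One step of the voting process *)

Lemma sqr_le1 (R : realFieldType) (x : R) : -1 <= x <= 1 -> 0 <= x ^+ 2 <= 1.
Proof. by move=> /andP[? ?]; rewrite sqr_ge0 /=; nra. Qed.

Section OneStep.
Variables (R : realFieldType) (V : finType) (pi : V -> R) (P : V -> V -> R).
Implicit Types A B : {set V}.

Definition opinion B (v : V) : R := 2 * (v \in B)%:R - 1.
Definition bias B : R := avg pi (opinion B).
Definition unevenness B : R :=
  avg pi (fun v => (walk P (opinion B) v - bias B) ^+ 2).

Lemma opinion_sqr B v : opinion B v ^+ 2 = 1.
Proof. by rewrite /opinion; case: (v \in B) => /=; ring. Qed.

Variables (N c lam : R).
Hypothesis E : expander pi P N c lam.

Variables (m : voting) (A : {set V}).
Let e v := mean_opinion m (opinion A v) (walk P (opinion A) v).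
Let mu := avg pi e.
Definition update_prob v : R :=
  (1 + mean_opinion m (opinion A v) (walk P (opinion A) v)) / 2.
Let q := update_prob.

Lemma mean_opinion_set_bounds v : -1 <= e v <= 1.
Proof. exact: (ebound E (opinion_sqr A)). Qed.

Lemma update_prob_vector : prob_vector q.
Proof.
move=> v; have /andP[e1 e2] := mean_opinion_set_bounds v.
by rewrite /q /update_prob -/(e v); apply/andP; split; lra.
Qed.

Lemma update_var v : q v * (1 - q v) = (1 - e v ^+ 2) / 4.
Proof. by rewrite /q /update_prob -/(e v); field. Qed.

Lemma opinion_noise B v : opinion B v = e v + 2 * ((v \in B)%:R - q v).
Proof. by rewrite /q /update_prob -/(e v) /opinion; field. Qed.

Lemma bias_noise B : bias B = mu + noise q (fun v => 2 * pi v) B.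
Proof.
rewrite /noise /bias /mu /avg -big_split; apply: eq_bigr => v _ /=.
by rewrite opinion_noise; ring.
Qed.

Lemma walk_noise B v :
  walk P (opinion B) v = walk P e v + noise q (fun u => 2 * P v u) B.
Proof.
rewrite /noise /walk -big_split; apply: eq_bigr => u _ /=.
by rewrite opinion_noise; ring.
Qed.

Let cN_gt0 : 0 < c * N.
Proof. by rewrite (lt_le_trans ltr01) // (expander_N E). Qed.

Lemma local_noise_le v :
  \sum_u (2 * P v u) ^+ 2 * (q u * (1 - q u)) <= 1 / (c * N).
Proof.
rewrite -[leRHS]mulr1 -[X in _ <= _ * X](expander_P_sum E v) mulr_sumr; apply: ler_sum => u _.
rewrite update_var (_ : (2 * _) ^+ 2 * _ = P v u ^+ 2 * (1 - e u ^+ 2)); last by field.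
have := expander_P_ge0 E v u; have := expander_P_le E v u; set x := P v u => x1 x0.
apply: (@le_trans _ _ (x ^+ 2)); last by rewrite expr2 ler_wpM2r.
by rewrite ler_piMr ?sqr_ge0 // lerBlDr lerDl sqr_ge0.
Qed.

(** The unevenness of the expected opinions has been damped; resampling adds
    what is left of independent noise after averaging over a neighbourhood. *)
Lemma unevenness_step :
  bexp q unevenness <= 3 / 4 * unevenness A + 1 / (c * N).
Proof.
have q01 := update_prob_vector.
pose f B v := (walk P e v - mu) ^+ 2
  + (2 * (walk P e v - mu)) * noise q (fun u => 2 * P v u) B
  + noise q (fun u => 2 * P v u) B ^+ 2.
apply: (@le_trans _ _ (bexp q (fun B => avg pi (f B)))).
  apply: ler_bexp => // B; rewrite /unevenness.
  have := avg_centered_le E (walk P (opinion B)) mu.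
  rewrite (avg_walk E) -/(bias B) => h; apply: (le_trans h).
  rewrite le_eqVlt; apply/orP; left; apply/eqP; apply: eq_avg => v.
  by rewrite /f walk_noise; ring.
rewrite /avg bexp_sum.
apply: (@le_trans _ _ (avg pi (fun v => (walk P e v - mu) ^+ 2 + 1 / (c * N)))).
  apply: ler_sum => v _; rewrite bexpZ ler_wpM2l ?(expander_pi_ge0 E) //.
  rewrite /f !bexpD bexpZ bexp_cst bexp_noise bexp_noise2 mulr0 addr0 lerD2l.
  exact: local_noise_le.
rewrite avgD (avg_cst E) lerD2r.
exact: (unevenness_drift E (opinion_sqr A)).
Qed.

Let v2 := \sum_u (2 * pi u) ^+ 2 * (q u * (1 - q u)).

Lemma bias_varE : v2 = \sum_u pi u ^+ 2 * (1 - e u ^+ 2).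
Proof. by apply: eq_bigr => u _; rewrite update_var; field. Qed.

Let sure_ge0 u : 0 <= 1 - e u ^+ 2.
Proof. by have /sqr_le1/andP[_] := mean_opinion_set_bounds u; rewrite subr_ge0. Qed.

Lemma bias_var_le : v2 <= 1 / (c * N) * avg pi (fun u => 1 - e u ^+ 2).
Proof.
rewrite bias_varE mulr_sumr; apply: ler_sum => u _.
by rewrite mulrA ler_wpM2r // expr2 ler_wpM2r ?(expander_pi_ge0 E) // (expander_pi_le E).
Qed.

Lemma bias_var_ge : c / N * avg pi (fun u => 1 - e u ^+ 2) <= v2.
Proof.
rewrite bias_varE mulr_sumr; apply: ler_sum => u _.
by rewrite mulrA ler_wpM2r // expr2 ler_wpM2r ?(expander_pi_ge0 E) // (expander_pi_ge E).
Qed.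

Lemma bias_moment4 :
  bexp q (fun B => noise q (fun u => 2 * pi u) B ^+ 4) <=
  3 * v2 ^+ 2 + 4 * (1 / (c * N)) ^+ 2 * v2.
Proof.
apply: le_trans (bexp_noise4 _ update_prob_vector) _; rewrite lerD2l.
rewrite [X in _ * X]bias_varE mulr_sumr; apply: ler_sum => u _.
rewrite update_var (_ : (2 * _) ^+ 4 * _ = 4 * (pi u ^+ 2 * (pi u ^+ 2 * (1 - e u ^+ 2))));
  last by field.
rewrite -mulrA ler_wpM2l // ler_wpM2r //; first by rewrite mulr_ge0 ?sqr_ge0.
rewrite ler_sqr ?nnegrE ?(expander_pi_ge0 E) ?(expander_pi_le E) //.
by rewrite divr_ge0 // ltW.
Qed.

Definition potential B : R :=
  (1 - bias B ^+ 2) / (reg c / N + bias B ^+ 2).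

Let k := reg c / N.
Let k_gt0 : 0 < k.
Proof.
exact: divr_gt0 (reg_gt0 (expander_c E)) (expander_N_gt0 E).
Qed.

Lemma potentialE B : potential B = (1 + k) * (1 / (k + bias B ^+ 2)) - 1.
Proof.
rewrite /potential -/k; field.
by rewrite gt_eqF // ltr_pwDl ?sqr_ge0.
Qed.

(** Taking expectations in the quadratic bound of [inv_second_order] at the
    square of the mean bias turns the variance of the bias into a gain. *)
Lemma inv_sqr_bias_step (h := k + mu ^+ 2) :
  bexp q (fun B => 1 / (k + bias B ^+ 2)) <=
  1 / h - (v2 - (8 * mu ^+ 2 * v2
     + 2 * bexp q (fun B => noise q (fun u => 2 * pi u) B ^+ 4)) / k) / h ^+ 2.
Proof.
have h0 : 0 < h by rewrite ltr_pwDl ?sqr_ge0.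
set E4 := bexp q (fun B => _ ^+ 4).
pose X B := noise q (fun u => 2 * pi u) B.
apply: (@le_trans _ _ (bexp q (fun B => 1 / h
   + ((- (2 * mu) / h ^+ 2) * X B
   + ((- 1 / h ^+ 2 + 8 * mu ^+ 2 / (k * h ^+ 2)) * X B ^+ 2
   + (2 / (k * h ^+ 2)) * X B ^+ 4))))).
  apply: ler_bexp; first exact: update_prob_vector.
  move=> B; apply: le_trans (inv_second_order k_gt0 (sqr_ge0 mu) (sqr_ge0 _)) _.
  rewrite -/h bias_noise -/(X B); move: (X B) => x.
  rewrite -subr_ge0.
  have -> : 1 / h + (- (2 * mu) / h ^+ 2 * x
    + ((- 1 / h ^+ 2 + 8 * mu ^+ 2 / (k * h ^+ 2)) * x ^+ 2
    + 2 / (k * h ^+ 2) * x ^+ 4))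
    - (1 / h - ((mu + x) ^+ 2 - mu ^+ 2) / h ^+ 2
    + ((mu + x) ^+ 2 - mu ^+ 2) ^+ 2 / (k * h ^+ 2))
    = (x * (2 * mu - x)) ^+ 2 / (k * h ^+ 2).
    by field; rewrite !gt_eqF.
  by rewrite divr_ge0 ?sqr_ge0 // mulr_ge0 ?sqr_ge0 // ltW.
rewrite !bexpD !bexpZ bexp_cst bexp_noise bexp_noise2 -/v2 -/E4.
rewrite le_eqVlt; apply/orP; left; apply/eqP.
by field; rewrite !gt_eqF.
Qed.

Lemma potential_step :
  reg c <= N -> unevenness A ^+ 2 <= even_tol c / N ->
  bexp q potential <= (1 - rate c) * potential A.
Proof.
move=> KN wt; have cN1 := expander_N E.
have N0 := expander_N_gt0 E; have /andP[c0 c1] := expander_c E.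
have lam01 := expander_lam E.
have s2 := opinion_sqr A.
have d1 := dbound E s2; rewrite -/(bias A) in d1.
have w0 := unevenness_ge0 E (opinion A); rewrite -/(unevenness A) in w0.
have wl := unevenness_le E s2; rewrite -/(bias A) -/(unevenness A) in wl.
have [rho muE rho_le] := bias_drift E s2 m.
rewrite -/(bias A) -/(unevenness A) in muE rho_le.
rewrite -/e -/mu in muE.
have lo := bias_growth lam01 d1 w0 wl rho_le wt; rewrite -muE in lo.
have hi := bias_growth_le lam01 d1 w0 rho_le wt; rewrite -muE in hi.
have d01 := sqr_le1 d1.
have mu1 : 0 <= mu ^+ 2 <= 1.
  exact/sqr_le1/(avg_bound E mean_opinion_set_bounds).
have v0 : 0 <= v2.
  rewrite bias_varE; apply: sumr_ge0 => u _.
  by apply: mulr_ge0; rewrite ?sqr_ge0.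
have nuE : N^-1 / c = 1 / (c * N) by field; rewrite !gt_eqF.
have vhi : 0 <= v2 <= N^-1 / c * (1 - mu ^+ 2).
  rewrite v0 nuE; apply: le_trans bias_var_le _.
  rewrite ler_wpM2l ?divr_ge0 ?(ltW cN_gt0) //.
  exact: (mean_opinion_var_le E (opinion A) m).
have vlo : bias A ^+ 2 <= 1 / 64 -> c * N^-1 / 4 <= v2.
  move=> d64; apply: le_trans bias_var_ge.
  rewrite ler_wpM2l ?divr_ge0 // ?(ltW c0) ?(ltW N0) //.
  rewrite -[leLHS]mul1r; apply: (mean_opinion_var_ge E) => //.
  apply: le_trans wl _; have /andP[l0 l1] := lam01.
  have /andP[dd0 dd1] := d01.
  have : lam ^+ 2 <= 1 / 64 by nra.
  move=> h; apply: (@le_trans _ _ (1 / 64 * 1)); last by lra.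
  by apply: ler_pM; rewrite ?sqr_ge0 // ?subr_ge0 // lerBlDr lerDl.
have E4le := bias_moment4; rewrite -nuE in E4le.
have nu_c : 0 < N^-1 <= c.
  by rewrite invr_gt0 N0 /= -[N^-1]mul1r ler_pdivrMr.
have k1 : reg c * N^-1 <= 1 by rewrite ler_pdivrMr ?mul1r.
have c01 : 0 < c <= 1 by rewrite c0.
have := potential_balance c01 nu_c k1 d01 mu1 lo hi vhi vlo E4le.
rewrite -/k; set U := v2 - _ => main.
have h0 : 0 < k + mu ^+ 2 by rewrite ltr_pwDl ?sqr_ge0.
have g0 : 0 < k + bias A ^+ 2 by rewrite ltr_pwDl ?sqr_ge0.
apply: (@le_trans _ _ ((1 + k) * (1 / (k + mu ^+ 2) - U / (k + mu ^+ 2) ^+ 2) - 1)).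
  rewrite (eq_bexp _ potentialE) bexpD bexpZ bexp_cst lerD2r ler_wpM2l //.
    by rewrite addr_ge0 // ltW.
  exact: inv_sqr_bias_step.
rewrite potentialE; move: main; set d := bias A ^+ 2; set M := mu ^+ 2.
rewrite -/d -/M in h0 g0 d01 mu1 *.
move=> main.
rewrite -subr_ge0.
have -> : (1 - rate c) * ((1 + k) * (1 / (k + d)) - 1) -
  ((1 + k) * (1 / (k + M) - U / (k + M) ^+ 2) - 1) =
  ((1 + k) * ((M - d) * (k + M) + U * (k + d)) - rate c * (1 - d) * (k + M) ^+ 2)
    / ((k + d) * (k + M) ^+ 2).
  by field; rewrite !gt_eqF.
apply: divr_ge0; last by apply: mulr_ge0; rewrite ?sqr_ge0 // ltW.
rewrite subr_ge0.
apply: (le_trans main); rewrite -[leLHS]mul1r.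
apply: ler_wpM2r; last by rewrite lerDl ltW.
apply: le_trans main; apply: mulr_ge0; last exact: sqr_ge0.
have /andP[dd0 dd1] := d01; apply: mulr_ge0; last by rewrite subr_ge0.
by have /rate_range/andP[/ltW] := c01.
Qed.

End OneStep.

(** * Quasirandom graphs are expanders *)

Section QuasirandomGraph.
Variables (R : realFieldType) (V : finType) (a : rel V).
Hypothesis a_sym : symmetric a.
Variables (p c : R).
Let n : R := #|V|%:R.

Definition degree (v : V) : R := \sum_u (a v u)%:R.
Definition deviation (u v : V) : R := (a u v)%:R - p.
Definition deviation_sqr (u v : V) : R :=
  \sum_w deviation u w * deviation w v.

Hypotheses (c01 : 0 < c <= 1) (cn_ge1 : 1 <= c * n).
Hypothesis deg_ge : forall v, c * n <= degree v.
Hypothesis dev2_le :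
  \sum_u \sum_v deviation_sqr u v ^+ 2 <= (c ^+ 2 / 100 / 100) ^+ 2 * n ^+ 4.

Definition volume : R := \sum_v degree v.
Definition stationary (v : V) : R := degree v / volume.
Definition transition (v u : V) : R := (a v u)%:R / degree v.

Let c0 : 0 < c. Proof. by have /andP[] := c01. Qed.
Let cn0 : 0 < c * n. Proof. exact: lt_le_trans ltr01 cn_ge1. Qed.
Let n0 : 0 < n. Proof. by rewrite -(pmulr_rgt0 _ c0). Qed.
Let deg0 v : 0 < degree v. Proof. exact: lt_le_trans cn0 (deg_ge v). Qed.

Let sum1 : \sum_(v : V) (1 : R) = n.
Proof. by rewrite sumr_const. Qed.

Let degn v : degree v <= n.
Proof. by rewrite -sum1; apply: ler_sum => u _; case: (a v u). Qed.

Let vol_ge : c * n * n <= volume.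
Proof.
by rewrite -{2}sum1 mulr_sumr; apply: ler_sum => v _; rewrite mulr1.
Qed.

Let vol_le : volume <= n * n.
Proof. by rewrite -{2}sum1 mulr_sumr; apply: ler_sum => v _; rewrite mulr1. Qed.

Let vol0 : 0 < volume.
Proof. by apply: lt_le_trans vol_ge; rewrite mulr_gt0. Qed.

(** The Frobenius norm of the square of the deviation matrix, that is, its
    fourth Schatten norm, bounds its operator norm. *)
Lemma deviation_norm f :
  \sum_v (\sum_u deviation v u * f u) ^+ 2 <=
  c ^+ 2 / 100 / 100 * n ^+ 2 * \sum_u f u ^+ 2.
Proof.
set F := \sum_u f u ^+ 2; set g := c ^+ 2 / 100 / 100.
have F0 : 0 <= F by apply: sumr_ge0 => u _; rewrite sqr_ge0.
have g0 : 0 <= g by rewrite /g !divr_ge0 ?sqr_ge0.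
have dsym u v : deviation u v = deviation v u by rewrite /deviation a_sym.
have -> : \sum_v (\sum_u deviation v u * f u) ^+ 2 =
   \sum_(uv : V * V) 1 * (f uv.1 * f uv.2 * deviation_sqr uv.1 uv.2).
  rewrite -(pair_bigA _ (fun u v => 1 * (f u * f v * deviation_sqr u v))) /=.
  transitivity (\sum_w \sum_u \sum_v (deviation w u * f u) * (deviation w v * f v)).
    by apply: eq_bigr => w _; rewrite expr2 mulr_suml; apply: eq_bigr => u _;
      rewrite mulr_sumr.
  rewrite exchange_big; apply: eq_bigr => u _ /=.
  rewrite exchange_big; apply: eq_bigr => v _ /=.
  rewrite mul1r /deviation_sqr mulr_sumr; apply: eq_bigr => w _.
  by rewrite (dsym u w); ring.
set X := \sum_uv _.
have X2 : X ^+ 2 <= (g * n ^+ 2 * F) ^+ 2.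
  apply: le_trans (Cauchy_Schwarz_sum _ _ _) _ => //.
  have -> : (g * n ^+ 2 * F) ^+ 2 = F ^+ 2 * (g ^+ 2 * n ^+ 4) by ring.
  have -> : \sum_(j : V * V) 1 * (f j.1 * f j.2) ^+ 2 = F ^+ 2.
    rewrite -(pair_bigA _ (fun u v => 1 * (f u * f v) ^+ 2)) /= expr2 /F mulr_suml.
    apply: eq_bigr => u _; rewrite mulr_sumr; apply: eq_bigr => v _.
    by rewrite mul1r exprMn.
  rewrite ler_wpM2l ?sqr_ge0 //; apply: le_trans dev2_le.
  rewrite (pair_bigA _ (fun u v => deviation_sqr u v ^+ 2)) /=.
  by apply: ler_sum => uv _; rewrite mul1r.
have Y0 : 0 <= g * n ^+ 2 * F.
  exact: mulr_ge0 (mulr_ge0 g0 (sqr_ge0 _)) F0.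
case: (lerP 0 X) => X0; last by rewrite (le_trans (ltW X0)).
by rewrite -ler_sqr.
Qed.

(** The degrees are the image of the constant function, hence close to
    [n * p]. So a function of [stationary]-mean zero has almost zero sum, and
    the adjacency matrix acts on it almost as the deviation matrix. *)
Lemma quasirandom_gap f : avg stationary f = 0 ->
  avg stationary (fun v => walk transition f v ^+ 2) <=
  (1 / 50) ^+ 2 * avg stationary (fun v => f v ^+ 2).
Proof.
move=> f0; set F := \sum_u f u ^+ 2; set g := c ^+ 2 / 100 / 100.
set s := \sum_u f u.
have g0 : 0 <= g by rewrite /g !divr_ge0 ?sqr_ge0.
have df0 : \sum_v degree v * f v = 0.
  move: f0; rewrite /avg /stationary => f0.
  transitivity (volume * \sum_v degree v / volume * f v); last by rewrite f0 mulr0.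
  rewrite mulr_sumr; apply: eq_bigr => v _.
  by field; rewrite gt_eqF.
have dev1 v : \sum_u deviation v u * 1 = degree v - n * p.
  rewrite /deviation; under eq_bigr do rewrite mulr1.
  by rewrite big_split /= sumrN sumr_const mulr_natl.
have ps : (p * s) ^+ 2 * n <= g * n ^+ 2 * F.
  have := deviation_norm (fun=> 1).
  under eq_bigr do rewrite dev1.
  under [X in _ <= _ * X]eq_bigr do rewrite expr1n.
  rewrite sum1 -/g => D1.
  have := @Cauchy_Schwarz_sum R V (fun=> 1) (fun v => degree v - n * p) f (fun=> ler01).
  have -> : \sum_j 1 * ((degree j - n * p) * f j) = - (n * (p * s)).
    rewrite (eq_bigr (fun j => degree j * f j + (- (n * p)) * f j)); last first.
      by move=> j _; ring.
    by rewrite big_split /= df0 -mulr_sumr -/s; ring.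
  under eq_bigr do rewrite mul1r.
  under [X in _ <= _ * X]eq_bigr do rewrite mul1r.
  rewrite -/F => CS.
  have F0 : 0 <= F by apply: sumr_ge0 => u _; rewrite sqr_ge0.
  have := le_trans CS (ler_wpM2r F0 D1).
  have -> : (- (n * (p * s))) ^+ 2 = n * ((p * s) ^+ 2 * n) by ring.
  have -> : g * n ^+ 2 * n * F = n * (g * n ^+ 2 * F) by ring.
  by rewrite ler_pM2l.
pose Af v := degree v * walk transition f v.
have AfE v : Af v = \sum_u deviation v u * f u + p * s.
  rewrite /Af /walk /s !mulr_sumr -big_split /=; apply: eq_bigr => u _.
  by rewrite /transition /deviation; field; rewrite gt_eqF.
have Af_le : \sum_v Af v ^+ 2 <= 4 * g * n ^+ 2 * F.
  apply: (@le_trans _ _ (\sum_v (2 * (\sum_u deviation v u * f u) ^+ 2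
      + 2 * (p * s) ^+ 2 * 1))).
    apply: ler_sum => v _; rewrite AfE mulr1.
    set x := \sum_u _; set y := p * s; have := sqr_ge0 (x - y).
    by move=> *; lra.
  rewrite big_split /= -!mulr_sumr sum1.
  have := deviation_norm f; rewrite -/g -/F; move: ps.
  by move: (\sum_v _) => x *; lra.
apply: (@le_trans _ _ ((\sum_v Af v ^+ 2) / (c * n * volume))).
  rewrite mulr_suml; apply: ler_sum => v _.
  have -> : stationary v * walk transition f v ^+ 2
      = Af v ^+ 2 / (degree v * volume).
    by rewrite /Af /stationary; field; rewrite !gt_eqF.
  rewrite ler_wpM2l ?sqr_ge0 // lef_pV2 ?posrE ?mulr_gt0 //.
  by rewrite ler_wpM2r // ltW.
have F_le : F <= volume * avg stationary (fun v => f v ^+ 2) / (c * n).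
  rewrite ler_pdivlMr // /F /avg mulr_suml mulr_sumr; apply: ler_sum => v _.
  have -> : volume * (stationary v * f v ^+ 2) = f v ^+ 2 * degree v.
    by rewrite /stationary; field; rewrite gt_eqF.
  by rewrite ler_wpM2l ?sqr_ge0.
rewrite ler_pdivrMr ?mulr_gt0 //; apply: le_trans Af_le _.
apply: (@le_trans _ _ (4 * g * n ^+ 2 *
  (volume * avg stationary (fun v => f v ^+ 2) / (c * n)))).
  by rewrite ler_wpM2l // mulr_ge0 ?sqr_ge0 // mulr_ge0.
rewrite le_eqVlt; apply/orP; left; apply/eqP.
by rewrite /g; field; rewrite !gt_eqF.
Qed.

Lemma quasirandom_expander : expander stationary transition n c (1 / 50).
Proof.
have /andP[_ c1] := c01.
split=> //.
- by apply/andP; split; lra.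
- move=> v; rewrite /stationary ler_pdivlMr //.
  apply: le_trans (deg_ge v); rewrite mulrAC ler_pdivrMr //.
  by rewrite -mulrA ler_wpM2l // ltW.
- move=> v; rewrite /stationary ler_pdivrMr // mul1r mulrC ler_pdivlMr //.
  apply: le_trans vol_ge; rewrite mulrC ler_wpM2l // ltW //.
- by rewrite /stationary -mulr_suml divff // gt_eqF.
- by move=> v u; rewrite /transition divr_ge0 // ltW.
- move=> v u; rewrite /transition; case: (a v u); last first.
    by rewrite mul0r divr_ge0 // ltW.
  by rewrite !mul1r lef_pV2 ?posrE.
- by move=> v; rewrite /transition -mulr_suml -/(degree v) divff // gt_eqF.
- move=> v u; rewrite /stationary /transition (a_sym u v).
  by field; rewrite !gt_eqF.
- exact: quasirandom_gap.
Qed.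

End QuasirandomGraph.

(** * The law of a step on a graph *)

Lemma card_sumr (R : realFieldType) (T : finType) (S : {set T}) :
  #|S|%:R = \sum_x (x \in S)%:R :> R.
Proof.
rewrite -natr_sum -sum1_card big_mkcond /=.
by congr (_%:R); apply: eq_bigr => x _; case: (x \in S).
Qed.

Section Sampling.
Variables (R : realFieldType) (n : nat) (N A : {set 'I_n}).

Definition sample_count (k : nat) (H : seq bool -> bool) : R :=
  \sum_(s : k.-tuple 'I_n)
    (all (fun u => u \in N) s && H [seq u \in A | u <- s])%:R.

Lemma sample_count0 H : sample_count 0 H = (H [::])%:R.
Proof.
rewrite /sample_count (big_pred1 [tuple]) // => s.
by rewrite [s]tuple0; symmetry; apply/eqP.
Qed.

(** The samples are independent, and only the opinion of each one matters. *)
Lemma sample_countS k H :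
  sample_count k.+1 H =
  #|N :&: A|%:R * sample_count k (fun l => H (true :: l)) +
  #|N :\: A|%:R * sample_count k (fun l => H (false :: l)).
Proof.
rewrite /sample_count.
rewrite (reindex (fun xs : 'I_n * k.-tuple 'I_n => cons_tuple xs.1 xs.2)) /=;
  last first.
  exists (fun s => (thead s, behead_tuple s)) => [[x s] _ /=|s _].
    by congr pair; apply: val_inj.
  by rewrite [RHS]tuple_eta; apply: val_inj.
rewrite -(pair_bigA _ (fun x (s : k.-tuple 'I_n) =>
  ((x \in N) && all (fun u => u \in N) s &&
   H ((x \in A) :: [seq u \in A | u <- s]))%:R)) /=.
transitivity (\sum_(x : 'I_n) ((x \in N :&: A)%:R *
     sample_count k (fun l => H (true :: l)) +
    (x \in N :\: A)%:R * sample_count k (fun l => H (false :: l)))).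
  apply: eq_bigr => x _; rewrite !inE.
  case: (x \in N); case: (x \in A) => /=; rewrite ?mul1r ?mul0r ?addr0 ?add0r //.
    by rewrite big1.
  by rewrite big1.
by rewrite big_split /= -!mulr_suml -!card_sumr.
Qed.

End Sampling.

Section Adjacency.
Variable n : nat.
Implicit Types (G : graph n) (u v w : 'I_n) (e : vpair n).

Definition adj G : rel 'I_n := fun u v => v \in neighbors G u.

Lemma adjE G u v : adj G u v = [exists e in G, val e == [set v; u]%SET].
Proof. by rewrite /adj inE. Qed.

Lemma adj_sym G : symmetric (adj G).
Proof. by move=> u v; rewrite !adjE finset.setUC. Qed.

Lemma adj_irr G u : adj G u u = false.
Proof.
rewrite adjE; apply/existsP => -[e /andP[_ /eqP eu]].
by have := valP e; rewrite /= eu finset.setUid cards1.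
Qed.

Lemma edgeP u v : u != v -> exists e : vpair n, val e = [set v; u]%SET.
Proof.
move=> uv; have h : #|[set v; u]%SET| == 2%N by rewrite cards2 (eq_sym v) uv.
by exists (@exist _ (fun x : {set 'I_n} => #|x| == 2%N) _ h).
Qed.

Lemma adj_edge e G u v : val e = [set v; u]%SET -> adj G u v = (e \in G).
Proof.
move=> eE; rewrite adjE; apply/existsP/idP => [[e' /andP[e'G /eqP e'E]]|eG].
  by rewrite (val_inj (etrans eE (esym e'E))).
by exists e; rewrite eG eE eqxx.
Qed.

Lemma adj_setU1 e G u v :
  val e != [set v; u]%SET -> adj (e |: G)%SET u v = adj G u v.
Proof.
move=> eN; rewrite !adjE; apply/existsP/existsP => -[f /andP[fG fE]]; exists f.
  move: fG; rewrite fE andbT finset.in_setU1 => /orP[/eqP fe|//].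
  by rewrite -fe fE in eN.
by rewrite fE inE fG orbT.
Qed.

End Adjacency.

Section StepLaw.
Variables (R : realType) (n : nat) (G : graph n) (m : voting) (A : {set 'I_n}).

Lemma degree_card v : degree R (adj G) v = #|neighbors G v|%:R.
Proof.
by rewrite card_sumr.
Qed.

Lemma opinion1_probE v : 0 < degree R (adj G) v ->
  opinion1_prob R m G A v = update_prob (transition R (adj G)) m A v.
Proof.
move=> d0; rewrite /opinion1_prob.
have dE := degree_card v; set N := neighbors G v in dE *.
case: eqP => [N0|_]; first by rewrite dE N0 cards0 ltxx in d0.
rewrite natrX -dE.
rewrite card_sumr.
under eq_bigr do rewrite inE.
rewrite -/(sample_count R N A (samples m) (new_opinion m (v \in A))).
set x : R := #|N :&: A|%:R; set y : R := #|N :\: A|%:R.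
have xy : degree R (adj G) v = x + y by rewrite dE -natrD cardsID.
have zE : walk (transition R (adj G)) (opinion R A) v = (x - y) / (x + y).
  have -> : x - y = \sum_u (adj G v u)%:R * opinion R A u.
    rewrite /x /y !card_sumr -sumrB.
    apply: eq_bigr => u _; rewrite finset.in_setI finset.in_setD /opinion /adj -/N.
    by case: (u \in N); case: (u \in A) => /= ; ring.
  rewrite /walk mulr_suml; apply: eq_bigr => u _.
  by rewrite /transition xy mulrAC.
have xy0 : x + y != 0 by rewrite -xy gt_eqF.
rewrite /update_prob zE xy /opinion.
case: (m); rewrite /= !sample_countS !sample_count0 /= -/x -/y.
  by case: (v \in A) => /=; field.
by field.
Qed.

End StepLaw.

(** * Binomial random graphs are dense and quasirandom *)

Section RandomGraph.
Variables (R : realType) (p : R) (n : nat).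
Hypothesis p01 : 0 <= p <= 1.
Implicit Types (G : graph n) (u v w : 'I_n) (e : vpair n).

Let q (e : vpair n) := p.
Let xi u v G : R := deviation (adj G) p u v.

Let q01 : prob_vector q. Proof. by move=> e. Qed.

Let xi_sym u v G : xi u v G = xi v u G.
Proof. by rewrite /xi /deviation adj_sym. Qed.

Let xi_le u v G : -1 <= xi u v G <= 1.
Proof.
have /andP[p0 p1] := p01.
by rewrite /xi /deviation; case: (adj G u v); apply/andP; split; rewrite /=; lra.
Qed.

(** A potential edge is independent of everything that does not look at it. *)
Lemma bexp_edge0 u v (F : graph n -> R) : u != v ->
  (forall e G, val e = [set v; u]%SET -> F (e |: G)%SET = F G) ->
  bexp q (fun G => xi u v G * F G) = 0.
Proof.
move=> /edgeP[e eE] Fe.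
rewrite (@eq_bexp _ _ _ _ (fun G => ((e \in G)%:R - p) * F G)); last first.
  by move=> G; rewrite /xi /deviation (adj_edge _ eE).
rewrite (bexp_coord q (fun b => b%:R - p)); last by move=> G; exact: Fe.
by rewrite /q /=; ring.
Qed.

(** Fourth moments, because all [n] degrees have to be close to their mean at
    the same time, which second moments would not give. *)
Lemma degree_moment4 v :
  bexp q (fun G => (\sum_(u | u != v) xi v u G) ^+ 4) <= 4 * n%:R ^+ 2.
Proof.
have n1 : 1 <= n%:R :> R by rewrite ler1n (leq_ltn_trans _ (ltn_ord v)).
case: (pickP (fun u => u != v)) => [u0 u0v|no]; last first.
  under eq_bexp do rewrite big_pred0 ?expr0n //.
  by rewrite bexp_cst mulr_ge0 ?sqr_ge0.
rewrite eq_sym in u0v; have [e0 _] := edgeP u0v.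
pose ed u := insubd e0 [set u; v]%SET.
have edE u : u != v -> val (ed u) = [set u; v]%SET.
  by move=> uv; rewrite /ed insubdK // unfold_in /= cards2 uv.
pose r := [seq ed u | u <- enum 'I_n & u != v].
have ur : uniq r.
  rewrite map_inj_in_uniq => [|u u']; first exact: (filter_uniq _ (enum_uniq _)).
  rewrite !mem_filter => /andP[uv _] /andP[u'v _] /(congr1 val).
  rewrite !edE // => /setP/(_ u); rewrite !inE eqxx (negbTE uv) !orbF.
  by move=> /esym/eqP.
have [_ _ /(_ q01)] := noise_moments_seq q (fun=> 1) ur.
have -> : \sum_(e <- r) 1 ^+ 2 * (q e * (1 - q e)) = \sum_(e <- r) p * (1 - p).
  by apply: eq_bigr => e _; rewrite expr1n mul1r.
have -> : \sum_(e <- r) 1 ^+ 4 * (q e * (1 - q e)) = \sum_(e <- r) p * (1 - p).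
  by apply: eq_bigr => e _; rewrite expr1n mul1r.
set s := \sum_(e <- r) p * (1 - p) => moments.
have s0 : 0 <= s <= n%:R.
  have /andP[p0 p1] := p01.
  have pp0 : 0 <= p * (1 - p) by rewrite mulr_ge0 // subr_ge0.
  have pp1 : p * (1 - p) <= 1 by rewrite mulr_ile1 // ?subr_ge0 // lerBlDr lerDl.
  rewrite /s sumr_ge0 //= big_const_seq count_predT iter_addr_0.
  rewrite -[leLHS]mulr_natr -[leRHS]mul1r; apply: ler_pM => //.
  rewrite ler_nat size_map size_filter (leq_trans (count_size _ _)) //.
  by rewrite -cardE card_ord.
rewrite (@eq_bexp _ _ _ _ (fun G =>
   (\sum_(e <- r) 1 * ((e \in G)%:R - q e)) ^+ 4)); last first.
  move=> G; congr (_ ^+ 4); rewrite /r big_map big_filter big_enum_cond.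
  by apply: eq_big => // u uv; rewrite mul1r /xi /deviation (adj_edge _ (edE _ uv)).
apply: (le_trans moments).
have /andP[s1 s2] := s0; nra.
Qed.

(** The summands are uncorrelated, since the pair [u], [w] occurs in the one
    of index [w] only. *)
Lemma codegree_moment2 u v : u != v ->
  bexp q (fun G => (\sum_(w | (w != u) && (w != v)) xi u w G * xi w v G) ^+ 2)
  <= n%:R.
Proof.
move=> uv.
have cross w w' : w != u -> w != v -> w' != u -> w' != v -> w != w' ->
    bexp q (fun G => xi u w G * xi w v G * (xi u w' G * xi w' v G)) = 0.
  move=> wu wv w'u w'v ww'.
  under eq_bexp do rewrite -mulrA.
  apply: bexp_edge0; first by rewrite eq_sym.
  move=> e G eE; rewrite /xi /deviation !adj_setU1 // eE.
  - apply/eqP => /setP/(_ u); rewrite !inE eqxx orbT (negbTE uv).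
    by rewrite eq_sym (negbTE w'u).
  - apply/eqP => /setP/(_ w); rewrite !inE eqxx (negbTE wu) orbF.
    by rewrite (negbTE ww').
  - apply/eqP => /setP/(_ u); rewrite !inE eqxx orbT (negbTE uv).
    by rewrite eq_sym (negbTE wu).
pose good w := (w != u) && (w != v).
rewrite (@eq_bexp _ _ _ _ (fun G => \sum_(w | good w) \sum_(w' | good w')
    xi u w G * xi w v G * (xi u w' G * xi w' v G))); last first.
  by move=> G; rewrite expr2 mulr_suml; apply: eq_bigr => w _; rewrite mulr_sumr.
rewrite bexp_sum (_ : n%:R = \sum_(w : 'I_n) 1); last first.
  by rewrite sumr_const card_ord.
rewrite [leRHS](bigID good) /= -[leLHS]addr0 lerD ?sumr_ge0 //.
apply: ler_sum => w /andP[wu wv].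
rewrite bexp_sum (bigD1 w) /=; last by rewrite /good wu.
rewrite [X in _ + X]big1 ?addr0; last first.
  by move=> w' /andP[/andP[w'u w'v] w'w]; apply: cross => //; rewrite eq_sym.
rewrite -(bexp1 q); apply: ler_bexp => // G.
have /sqr_le1/andP[x0 x1] := xi_le u w G; have /sqr_le1/andP[y0 y1] := xi_le w v G.
by rewrite -expr2 exprMn mulr_ile1.
Qed.

(** The indices [w = u] and [w = v] give the diagonal entries [- p] of the
    deviation, whose contribution is bounded. *)
Lemma deviation_sqr_moment u v : u != v ->
  bexp q (fun G => deviation_sqr (adj G) p u v ^+ 2) <= 10 * n%:R.
Proof.
move=> uv.
have n1 : 1 <= n%:R :> R by rewrite ler1n (leq_ltn_trans _ (ltn_ord v)).
apply: (@le_trans _ _ (bexp q (fun G =>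
  8 + 2 * (\sum_(w | (w != u) && (w != v)) xi u w G * xi w v G) ^+ 2))).
  apply: ler_bexp => // G; rewrite /deviation_sqr.
  rewrite (bigD1 u) //= (bigD1 v) /=; last by rewrite eq_sym.
  rewrite -!/(xi _ _ G).
  have xx w : xi w w G = - p by rewrite /xi /deviation adj_irr sub0r.
  rewrite !xx; have /sqr_le1/andP[x0 x1] := xi_le u v G.
  have /andP[p0 p1] := p01.
  have p2 : p ^+ 2 <= 1 by rewrite expr_le1.
  have px : p ^+ 2 * xi u v G ^+ 2 <= 1 by rewrite mulr_ile1 ?sqr_ge0.
  under eq_bigr do rewrite -!/(xi _ _ G).
  move: px {x0 x1}; move: (xi u v G) (\sum_(_ | _) _) => x T px.
  have := sqr_ge0 (T + 2 * p * x); lra.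
rewrite bexpD bexpZ bexp_cst.
by have := codegree_moment2 uv; lra.
Qed.

Lemma deviation_norm_moment :
  bexp q (fun G => \sum_u \sum_v deviation_sqr (adj G) p u v ^+ 2)
  <= 11 * n%:R ^+ 3.
Proof.
rewrite bexp_sum.
apply: (@le_trans _ _ (\sum_(u : 'I_n) (11 * n%:R ^+ 2))); last first.
  rewrite sumr_const card_ord -mulr_natr; lra.
apply: ler_sum => u _; rewrite bexp_sum (bigD1 u) //=.
have diag : bexp q (fun G => deviation_sqr (adj G) p u u ^+ 2) <= n%:R ^+ 2.
  rewrite -(bexp_cst q (n%:R ^+ 2)); apply: ler_bexp => // G.
  have h : 0 <= deviation_sqr (adj G) p u u <= n%:R.
    have xx w : deviation (adj G) p u w * deviation (adj G) p w u = xi u w G ^+ 2.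
      by rewrite -!/(xi _ _ G) (xi_sym w u) expr2.
    rewrite /deviation_sqr; under eq_bigr do rewrite xx.
    rewrite sumr_ge0 /=; last by move=> w _; rewrite sqr_ge0.
    rewrite (_ : n%:R = \sum_(w : 'I_n) 1); last by rewrite sumr_const card_ord.
    by apply: ler_sum => w _; have /sqr_le1/andP[] := xi_le u w G.
  by have /andP[h0 h1] := h; rewrite ler_sqr ?nnegrE.
have offd : \sum_(v | v != u) bexp q (fun G => deviation_sqr (adj G) p u v ^+ 2)
    <= 10 * n%:R ^+ 2.
  apply: (@le_trans _ _ (\sum_(v : 'I_n) (10 * n%:R))).
    rewrite [leRHS](bigID (fun v => v != u)) /= -[leLHS]addr0 lerD //.
      by apply: ler_sum => v vu; apply: deviation_sqr_moment; rewrite eq_sym.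
    by apply: sumr_ge0 => v _; rewrite mulr_ge0.
  by rewrite sumr_const card_ord -mulr_natr; lra.
lra.
Qed.

Lemma gnp_probE (E : set (graph n)) :
  gnp_prob p E = bexp q (fun G => (`[< E G >])%:R).
Proof.
rewrite /gnp_prob /bexp big_mkcond; apply: eq_bigr => G _.
by case: `[< E G >]; rewrite ?mulr1 ?mulr0.
Qed.

(** Markov's inequality for both quantities, and a union bound. *)
Lemma gnp_markov2 (E : set (graph n)) (F1 F2 : graph n -> R) (t1 t2 : R) :
  0 < t1 -> 0 < t2 -> (forall G, 0 <= F1 G) -> (forall G, 0 <= F2 G) ->
  (forall G, F1 G <= t1 -> F2 G <= t2 -> E G) ->
  1 - bexp q F1 / t1 - bexp q F2 / t2 <= gnp_prob p E.
Proof.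
move=> t10 t20 F10 F20 EF; rewrite gnp_probE.
apply: (@le_trans _ _ (bexp q (fun G => 1 + (- t1^-1) * F1 G + (- t2^-1) * F2 G))).
  by rewrite !bexpD !bexpZ bexp_cst; lra.
apply: ler_bexp => // G.
have h1 : 0 <= t1^-1 * F1 G by rewrite mulr_ge0 // invr_ge0 ltW.
have h2 : 0 <= t2^-1 * F2 G by rewrite mulr_ge0 // invr_ge0 ltW.
case: asboolP => /= [_|nE]; first by lra.
have [le1|gt1] := lerP (F1 G) t1; last first.
  have : 1 < t1^-1 * F1 G by rewrite mulrC ltr_pdivlMr // mul1r.
  lra.
have [le2|gt2] := lerP (F2 G) t2; last first.
  have : 1 < t2^-1 * F2 G by rewrite mulrC ltr_pdivlMr // mul1r.
  lra.
by case: nE; apply: EF.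
Qed.

Let c := p / 4.

Definition dense_quasirandom (G : graph n) : Prop :=
  (forall v, c * n%:R <= degree R (adj G) v) /\
  \sum_u \sum_v deviation_sqr (adj G) p u v ^+ 2
     <= (c ^+ 2 / 100 / 100) ^+ 2 * n%:R ^+ 4.

(** The sum of the fourth powers of the degree deviations is [O(n ^ 3)] on
    average, against [n ^ 4] for a single vertex of too small a degree; the
    fourth Schatten norm behaves in the same way. *)
Lemma gnp_quasirandom (E : set (graph n)) : 0 < p -> (1 < n)%N ->
  (forall G, dense_quasirandom G -> E G) ->
  1 - (4 / c ^+ 4 + 11 / (c ^+ 2 / 100 / 100) ^+ 2) / n%:R <= gnp_prob p E.
Proof.
move=> p0 n1 EG.
have c0 : 0 < c by rewrite divr_gt0.
have N2 : 2 <= n%:R :> R by rewrite ler_nat.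
have N0 : 0 < n%:R :> R by lra.
set N : R := n%:R in N2 N0 *.
pose g := c ^+ 2 / 100 / 100; have g0 : 0 < g by rewrite !divr_gt0 ?exprn_gt0.
pose F1 G := \sum_v (\sum_(u | u != v) xi v u G) ^+ 4.
pose F2 G := \sum_u \sum_v deviation_sqr (adj G) p u v ^+ 2.
have t10 : 0 < (c * N) ^+ 4 by rewrite exprn_gt0 // mulr_gt0.
have t20 : 0 < g ^+ 2 * N ^+ 4 by rewrite mulr_gt0 // exprn_gt0.
have pow4 (x : R) : 0 <= x ^+ 4 by rewrite (exprM _ 2 2) sqr_ge0.
have F10 G : 0 <= F1 G by apply: sumr_ge0.
have F20 G : 0 <= F2 G by do 2!apply: sumr_ge0 => ? _; rewrite sqr_ge0.
have EF G : F1 G <= (c * N) ^+ 4 -> F2 G <= g ^+ 2 * N ^+ 4 -> E G.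
  move=> h1 h2; apply: EG; split=> // v.
  set x := \sum_(u | u != v) xi v u G.
  have x4 : x ^+ 4 <= (c * N) ^+ 4.
    by apply: le_trans h1; rewrite /F1 (bigD1 v) //= lerDl sumr_ge0.
  have xle : - (c * N) <= x.
    have : `|x| <= c * N.
      rewrite -(ler_pXn2r (isT : (0 < 4)%N)) ?nnegrE ?(ltW (mulr_gt0 c0 N0)) //.
      by rewrite -normrX ger0_norm.
    by rewrite ler_norml => /andP[].
  have -> : degree R (adj G) v = x + (N - 1) * p.
    have -> : N - 1 = \sum_(u | u != v) 1.
      have -> : N = \sum_(u : 'I_n) 1 by rewrite sumr_const card_ord.
      by rewrite (bigD1 v) //= addrC addrK.
    rewrite mulr_suml -big_split /= /degree (bigD1 v) //= adj_irr add0r.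
    by apply: eq_bigr => u _; rewrite /xi /deviation mul1r subrK.
  have : (N - 1) * p = N * p - p by ring.
  have : 2 * p <= N * p by rewrite ler_wpM2r // ltW.
  have -> : c * N = N * p / 4 by rewrite /c; ring.
  rewrite /c in xle; lra.
apply: le_trans (gnp_markov2 t10 t20 F10 F20 EF).
have m1 : bexp q F1 <= 4 * N ^+ 3.
  rewrite /F1 bexp_sum; apply: (@le_trans _ _ (\sum_(v : 'I_n) 4 * N ^+ 2)).
    by apply: ler_sum => v _; exact: degree_moment4.
  by rewrite sumr_const card_ord -mulr_natr -/N; lra.
have m1' : bexp q F1 / (c * N) ^+ 4 <= 4 / c ^+ 4 / N.
  rewrite ler_pdivrMr //; apply: le_trans m1 _.
  by rewrite le_eqVlt; apply/orP; left; apply/eqP; field; rewrite !gt_eqF.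
have m2' : bexp q F2 / (g ^+ 2 * N ^+ 4) <= 11 / g ^+ 2 / N.
  rewrite ler_pdivrMr //; apply: le_trans deviation_norm_moment _.
  by rewrite le_eqVlt; apply/orP; left; apply/eqP; field; rewrite !gt_eqF.
rewrite -/g mulrDl; lra.
Qed.

End RandomGraph.

(** * Markov chains and the law of a voting process *)

Section FiniteMarkovChain.
Variables (R : realFieldType) (S : finType) (K : S -> S -> R).
Hypothesis K_ge0 : forall x y, 0 <= K x y.
Hypothesis K_sum : forall x, \sum_y K x y = 1.
Implicit Types (f g : S -> R).

Definition step_exp f (x : S) : R := \sum_y K x y * f y.
Definition evolve (k : nat) f : S -> R := iter k step_exp f.

Lemma ler_step_exp f g x : (forall y, f y <= g y) -> step_exp f x <= step_exp g x.
Proof. by move=> fg; apply: ler_sum => y _; rewrite ler_wpM2l. Qed.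

Lemma step_expD f g x :
  step_exp (fun y => f y + g y) x = step_exp f x + step_exp g x.
Proof. by rewrite /step_exp -big_split; apply: eq_bigr => y _; rewrite mulrDr. Qed.

Lemma step_expZ a f x : step_exp (fun y => a * f y) x = a * step_exp f x.
Proof. by rewrite /step_exp mulr_sumr; apply: eq_bigr => y _; rewrite mulrCA. Qed.

Lemma step_exp_cst a x : step_exp (fun=> a) x = a.
Proof. by rewrite /step_exp -mulr_suml K_sum mul1r. Qed.

Lemma step_exp_sum (J : Type) (r : seq J) (F : J -> S -> R) x :
  step_exp (fun y => \sum_(j <- r) F j y) x = \sum_(j <- r) step_exp (F j) x.
Proof. by rewrite /step_exp exchange_big; apply: eq_bigr => y _; rewrite mulr_sumr. Qed.

Lemma ler_evolve k f g x : (forall y, f y <= g y) -> evolve k f x <= evolve k g x.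
Proof.
by move=> fg; elim: k x => [|k IH] x //=; apply: ler_step_exp.
Qed.

Lemma evolve_affine k a b f x :
  evolve k (fun y => a * f y + b) x = a * evolve k f x + b.
Proof.
elim: k x => [|k IH] x //=.
transitivity (step_exp (fun y => a * evolve k f y + b) x).
  by apply: eq_bigr => y _; rewrite IH.
by rewrite step_expD step_expZ step_exp_cst.
Qed.

Lemma evolve_sum k (J : Type) (r : seq J) (F : J -> S -> R) x :
  evolve k (fun y => \sum_(j <- r) F j y) x = \sum_(j <- r) evolve k (F j) x.
Proof.
elim: k x => [|k IH] x //=; rewrite -step_exp_sum.
by apply: eq_bigr => y _; rewrite IH.
Qed.

Lemma evolve_cst k a x : evolve k (fun=> a) x = a.
Proof.
elim: k x => [|k IH] x //=; rewrite -[RHS](step_exp_cst a x).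
by apply: eq_bigr => y _; rewrite IH.
Qed.

Lemma evolve_ge0 k f x : (forall y, 0 <= f y) -> 0 <= evolve k f x.
Proof. by move=> f0; rewrite -(evolve_cst k 0 x); apply: ler_evolve. Qed.

Lemma evolve_add k l f x : evolve (k + l) f x = evolve k (evolve l f) x.
Proof. by rewrite /evolve iterD. Qed.

Lemma evolve_contraction (W : S -> R) a b k x : 0 <= a < 1 -> 0 <= b ->
  (forall y, step_exp W y <= a * W y + b) ->
  evolve k W x <= a ^+ k * W x + b / (1 - a).
Proof.
move=> /andP[a0 a1] b0 Wstep; have a1' : 0 < 1 - a by rewrite subr_gt0.
elim: k x => [|k IH] x; first by rewrite /= expr0 mul1r lerDl divr_ge0 // ltW.
rewrite /evolve iterSr.
apply: le_trans (ler_evolve k x Wstep) _.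
rewrite evolve_affine.
have -> : a ^+ k.+1 * W x + b / (1 - a) = a * (a ^+ k * W x + b / (1 - a)) + b.
  by rewrite exprS; field; rewrite gt_eqF.
by rewrite lerD2r ler_wpM2l.
Qed.

Variables (bad unfinished : pred S).

(** Split according to the first visit to a bad state: before it the potential
    decays geometrically on average, and the sum pays for its occurrence. *)
Lemma evolve_potential (Phi : S -> R) r b k x : 0 <= r -> 0 <= b ->
  (forall y, 0 <= Phi y) -> (forall y, unfinished y -> 1 <= b * Phi y) ->
  (forall y, ~~ bad y -> step_exp Phi y <= r * Phi y) ->
  evolve k (fun y => (unfinished y)%:R) x <=
  r ^+ k * (b * Phi x) + \sum_(j < k) evolve j (fun y => (bad y)%:R) x.
Proof.
move=> r0 b0 Phi0 un decay.
elim: k x => [|k IH] x /=.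
  rewrite big_ord0 addr0 expr0 mul1r; case: (boolP (unfinished x)) => [/un //|_].
  by rewrite mulr_ge0.
have bad0 j y : 0 <= evolve j (fun y => (bad y)%:R) y by apply: evolve_ge0.
rewrite big_ord_recl /=; case: (boolP (bad x)) => bx.
  apply: (@le_trans _ _ 1).
    rewrite -[leRHS](step_exp_cst 1 x); apply: ler_step_exp => y.
    rewrite -[leRHS](evolve_cst k 1 y); apply: ler_evolve => z.
    by case: (unfinished z).
  rewrite addrCA lerDl addr_ge0 //; last by apply: sumr_ge0 => i _; exact: (bad0 i.+1 x).
  by rewrite mulr_ge0 ?exprn_ge0 // mulr_ge0.
rewrite add0r; apply: le_trans (ler_step_exp x IH) _.
rewrite step_expD step_exp_sum lerD2r exprS -mulrA.
rewrite (_ : step_exp _ x = r ^+ k * (b * step_exp Phi x)); last first.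
  by rewrite -!step_expZ.
rewrite [leRHS]mulrCA ler_wpM2l ?exprn_ge0 // [leRHS]mulrCA ler_wpM2l //.
exact: decay.
Qed.

(** After a burn-in of [t] steps, during which [W] becomes small on average,
    the potential drives the chain to the end within [k] further steps. *)
Lemma evolve_unfinished (Phi W : S -> R) r b PhiM a b' om t k x :
  0 <= r -> 0 <= b -> (forall y, 0 <= Phi y <= PhiM) ->
  (forall y, unfinished y -> 1 <= b * Phi y) ->
  (forall y, ~~ bad y -> step_exp Phi y <= r * Phi y) ->
  0 <= a < 1 -> 0 <= b' -> (forall y, 0 <= W y <= 1) ->
  (forall y, step_exp W y <= a * W y + b') ->
  0 < om -> (forall y, bad y -> om <= W y) ->
  evolve (t + k) (fun y => (unfinished y)%:R) x <=
  r ^+ k * (b * PhiM) + k%:R * ((a ^+ t + b' / (1 - a)) / om).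
Proof.
move=> r0 b0 Phi01 un decay a01 b'0 W01 Wstep om0 badW.
have Phi0 y : 0 <= Phi y by have /andP[] := Phi01 y.
rewrite evolve_add.
apply: le_trans (ler_evolve _ _ (fun y => evolve_potential k y r0 b0 Phi0 un decay)) _.
apply: (@le_trans _ _ (evolve t (fun y => 1 * (\sum_(j < k) evolve j (fun y => (bad y)%:R) y)
    + r ^+ k * (b * PhiM)) x)).
  apply: ler_evolve => y; rewrite mul1r addrC lerD2l ler_wpM2l ?exprn_ge0 //.
  by rewrite ler_wpM2l //; have /andP[] := Phi01 y.
rewrite evolve_affine mul1r addrC lerD2l evolve_sum.
rewrite (_ : k%:R * _ = \sum_(j < k) ((a ^+ t + b' / (1 - a)) / om)); last first.
  by rewrite sumr_const card_ord mulr_natl.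
apply: ler_sum => j _; rewrite -evolve_add ler_pdivlMr //.
have /andP[a0 a1] := a01.
apply: (@le_trans _ _ (evolve (t + j) W x)).
  have := evolve_affine (t + j) om 0 (fun y => (bad y)%:R) x.
  rewrite addr0 mulrC => <-; apply: ler_evolve => y; rewrite addr0.
  case: (boolP (bad y)) => [/badW|_]; rewrite ?mulr1 ?mulr0 //.
  by have /andP[] := W01 y.
apply: le_trans (evolve_contraction (t + j) x a01 b'0 Wstep) _.
rewrite lerD2r exprD -mulrA ler_piMr ?exprn_ge0 //.
have /andP[w0 w1] := W01 x.
by rewrite mulr_ile1 // ?exprn_ge0 // exprn_ile1 // ltW.
Qed.

End FiniteMarkovChain.

Section ProcessLaw.
Local Open Scope classical_set_scope.
Variables (R : realType) (m : voting) (n : nat) (G : graph n) (A : {set 'I_n}).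
Variables (d : measure_display) (T : measurableType d) (P : probability T R).
Variable X : nat -> T -> {set 'I_n}.
Hypothesis vp : voting_process m G A P X.

Let path (t : nat) (B : nat -> {set 'I_n}) : set T :=
  [set w | forall s, (s <= t)%N -> X s w = B s].

Let pathS t B : path t.+1 B = path t B `&` [set w | X t.+1 w = B t.+1].
Proof.
apply/seteqP; split => w /=.
  by move=> h; split=> [s st|]; apply: h => //; exact: leqW.
by move=> [h1 h2] s; rewrite leq_eqVlt => /orP[/eqP->//|]; exact: h1.
Qed.

Let path0 B : path 0 B = [set w | X 0%N w = B 0%N].
Proof.
apply/seteqP; split => w /= h; first exact: h.
by move=> s; rewrite leqn0 => /eqP->.
Qed.

Let mX t B : measurable [set w | X t w = B]. Proof. exact: (voting_meas vp). Qed.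

Let mpath t B : measurable (path t B).
Proof.
elim: t => [|t IH]; first by rewrite path0.
by rewrite pathS; exact: measurableI.
Qed.

Lemma measurable_pred t (D : pred {set 'I_n}) : measurable [set w | D (X t w)].
Proof.
have -> : [set w | D (X t w)] =
    \big[setU/set0]_(B <- enum {set 'I_n} | D B) [set w | X t w = B].
  rewrite -bigcup_seq_cond; apply/seteqP; split => w /= h.
    by exists (X t w) => //=; rewrite mem_enum.
  by case: h => B /= /andP[_ DB] ->.
by apply: bigsetU_measurable => B _.
Qed.

Lemma partition_value t (F : set T) : measurable F ->
  P F = (\sum_(C : {set 'I_n}) P (F `&` [set w | X t w = C]))%E.
Proof.
move=> mF.
suff h (r : seq {set 'I_n}) : uniq r ->
    P (F `&` [set w | X t w \in r]) =
    (\sum_(C <- r) P (F `&` [set w | X t w = C]))%E.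
  rewrite -(h _ (index_enum_uniq _)); congr (P _).
  apply/seteqP; split => w /= => [Fw|[]//]; split=> //; exact: mem_index_enum.
elim: r => [_|C r IH /= /andP[Cr ur]].
  rewrite big_nil (_ : _ `&` _ = set0) ?measure0 //.
  by apply/seteqP; split => w //= [].
rewrite big_cons -IH // -measureU.
- congr (P _); apply/seteqP; split => w /=.
    by rewrite inE => -[Fw /orP[/eqP|]]; [left|right].
  by rewrite inE => -[[Fw ->]|[Fw ->]]; rewrite ?eqxx ?orbT.
- exact: measurableI.
- by apply: measurableI => //; exact: (measurable_pred t (fun B => B \in r)).
- apply/seteqP; split => w //= [[_ XC] [_ Xr]].
  by move: Cr; rewrite -XC Xr.
Qed.

(** Induction on [k], splitting according to the state at time [t.+1]. *)
Lemma markov_property (D : pred {set 'I_n}) k t B :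
  P (path t B `&` [set w | D (X (t + k)%N w)]) =
  (P (path t B) *
   (evolve (step_prob R m G) k (fun C => (D C)%:R) (B t))%:E)%E.
Proof.
elim: k t B => [|k IH] t B.
  rewrite addn0 /=; case: (boolP (D (B t))) => DB.
    rewrite mule1; congr (P _); apply/seteqP; split => w /= => [[]//|h].
    by split=> //; rewrite (h t).
  rewrite mule0 (_ : _ `&` _ = set0) ?measure0 //.
  by apply/seteqP; split => w //= [h]; rewrite (h t) // (negbTE DB).
rewrite (partition_value t.+1); last first.
  by apply: measurableI => //; exact: measurable_pred.
pose BC C s := if (s <= t)%N then B s else C : {set 'I_n}.
have pathC C : path t (BC C) = path t B.
  by apply/seteqP; split => w /= h s st; rewrite h // /BC st.
have x_fin : P (path t B) \is a fin_num by exact: fin_num_measure.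
rewrite -(fineK x_fin); set x := fine _.
transitivity (\sum_(C : {set 'I_n}) (x * (step_prob R m G (B t) C *
    evolve (step_prob R m G) k (fun C => (D C)%:R) C))%:E)%E.
  apply: eq_bigr => C _.
  have -> : path t B `&` [set w | D (X (t + k.+1)%N w)] `&` [set w | X t.+1 w = C]
     = path t.+1 (BC C) `&` [set w | D (X (t.+1 + k)%N w)].
    rewrite pathS pathC addSnnS (_ : BC C t.+1 = C) ?/BC ?ltnn //.
    by rewrite setIAC.
  rewrite IH (voting_step vp) -/(path t (BC C)) pathC -(fineK x_fin) -/x.
  by rewrite /BC ltnn leqnn -!EFinM mulrA.
by rewrite sumEFin -EFinM -mulr_sumr.
Qed.

Lemma process_law (D : pred {set 'I_n}) k :
  ((evolve (step_prob R m G) k (fun C => (D C)%:R) A)%:E <=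
   P [set w | D (X k w)])%E.
Proof.
have := markov_property D k 0 (fun=> A).
rewrite path0 (voting_init vp) mul1e add0n => <-.
apply: le_measure; rewrite ?inE; last by move=> w [].
  by apply: measurableI => //; exact: measurable_pred.
exact: measurable_pred.
Qed.

Lemma prob_consensus_at_le (k : nat) (x : R) : k%:R <= x ->
  (P [set w | consensus (X k w)] <=
   P [set w | (consensus_time R X w <= x%:E)%E])%E.
Proof.
move=> kx.
have ct w : (consensus_time R X w <= x%:E)%E <->
    exists2 t, t%:R <= x & consensus (X t w).
  rewrite /consensus_time; case: pselect => [ex|nex].
    rewrite lee_fin; case: ex_minnP => t ct tmin; split=> [tx|[s sx cs]].
      by exists t.
    by apply: le_trans sx; rewrite ler_nat tmin.
  split=> [|[t _ ct]]; first by rewrite leye_eq.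
  by case: nex; exists t.
have E : [set w | (consensus_time R X w <= x%:E)%E] =
    \bigcup_(t in [set t | t%:R <= x]) [set w | consensus (X t w)].
  by apply/seteqP; split => w /= => [/ct[t tx c]|[t tx c]]; [exists t|apply/ct; exists t].
apply: le_measure; rewrite ?inE.
- exact: measurable_pred.
- by rewrite E; apply: bigcup_measurable => t _; exact: measurable_pred.
- by move=> w c; apply/ct; exists k.
Qed.

End ProcessLaw.

(** * Voting on an expander *)

Section PotentialRange.
Variables (R : realFieldType) (V : finType) (pi : V -> R) (P : V -> V -> R).
Variables (N c lam : R).
Hypothesis E : expander pi P N c lam.
Implicit Types B : {set V}.

Lemma bias_bound B : 0 <= bias pi B ^+ 2 <= 1.
Proof. exact/sqr_le1/(dbound E (opinion_sqr R B)). Qed.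

(** Two vertices of different opinions already contribute a variance of order
    [1 / N]. *)
Lemma split_opinion_gap B u v : u \in B -> v \notin B ->
  2 * c / N <= 1 - bias pi B ^+ 2.
Proof.
move=> uB vB; rewrite -(opinion_variance E (opinion_sqr R B)) -/(bias pi B).
have uv : v != u by apply: contraNneq vB => ->.
rewrite /avg (bigD1 u) //= (bigD1 v) //= addrA.
set rest := \sum_(_ | _) _.
have rest0 : 0 <= rest.
  by apply: sumr_ge0 => x _; rewrite mulr_ge0 ?sqr_ge0 ?(expander_pi_ge0 E).
have ou : opinion R B u = 1 by rewrite /opinion uB /=; ring.
have ov : opinion R B v = -1 by rewrite /opinion (negbTE vB) /=; ring.
rewrite ou ov; move: (bias pi B) => d.
have hu := ler_wpM2r (sqr_ge0 (1 - d)) (expander_pi_ge E u).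
have hv := ler_wpM2r (sqr_ge0 (-1 - d)) (expander_pi_ge E v).
have h0 : 0 <= c / N * d ^+ 2.
  apply: mulr_ge0; last exact: sqr_ge0.
  have /andP[c0 _] := expander_c E.
  by rewrite divr_ge0 ?(ltW c0) ?(ltW (expander_N_gt0 E)).
have h1 : c / N * (1 - d) ^+ 2 + c / N * (-1 - d) ^+ 2 =
   2 * c / N + 2 * (c / N * d ^+ 2) by ring.
lra.
Qed.

Lemma potential_range B : 0 <= potential pi N c B <= N / reg c.
Proof.
have /andP[d0 d1] := bias_bound B; have N0 := expander_N_gt0 E.
have K0 := reg_gt0 (expander_c E).
have k0 : 0 < reg c / N by rewrite divr_gt0.
have h0 : 0 < reg c / N + bias pi B ^+ 2 by rewrite ltr_pwDl.
rewrite /potential divr_ge0 ?subr_ge0 ?(ltW h0) //=.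
rewrite ler_pdivrMr // mulrDr.
have -> : N / reg c * (reg c / N) = 1 by field; rewrite !gt_eqF.
have : 0 <= N / reg c * bias pi B ^+ 2.
  exact: mulr_ge0 (divr_ge0 (ltW N0) (ltW K0)) d0.
lra.
Qed.

Lemma potential_split B u v : reg c <= N -> u \in B -> v \notin B ->
  1 <= N / c * potential pi N c B.
Proof.
move=> KN uB vB.
have gap := split_opinion_gap uB vB.
have /andP[d0 d1] := bias_bound B; have N0 := expander_N_gt0 E.
have K0 := reg_gt0 (expander_c E).
have /andP[c0 _] := expander_c E.
have k0 : 0 < reg c / N by rewrite divr_gt0.
have k1 : reg c / N <= 1 by rewrite ler_pdivrMr // mul1r.
have h0 : 0 < reg c / N + bias pi B ^+ 2 by rewrite ltr_pwDl.
have h : N / c * (2 * c / N) <= N / c * (1 - bias pi B ^+ 2).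
  by rewrite ler_wpM2l // divr_ge0 ?(ltW N0) ?(ltW c0).
rewrite /potential mulrA ler_pdivlMr // mul1r.
have e : N / c * (2 * c / N) = 2 by field; rewrite !gt_eqF.
lra.
Qed.

Lemma unevenness_range B : 0 <= unevenness pi P B <= 1.
Proof.
have w0 := unevenness_ge0 E (opinion R B); rewrite -/(unevenness pi P B) in w0.
rewrite w0 /=; apply: le_trans (unevenness_le E (opinion_sqr R B)) _.
have /andP[d0 d1] := bias_bound B; have /andP[l0 l1] := expander_lam E.
have l2 : lam ^+ 2 <= 1 by apply: exprn_ile1 => //; lra.
by apply: mulr_ile1; rewrite ?sqr_ge0 ?subr_ge0 // lerBlDr lerDl.
Qed.

End PotentialRange.

Section VotingOnExpander.
Variables (R : realType) (n : nat) (G : graph n) (c lam : R).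
Let pi := stationary R (adj G).
Let P := transition R (adj G).
Let N : R := n%:R.
Hypothesis E : expander pi P N c lam.
Hypothesis deg0 : forall v, 0 < degree R (adj G) v.
Hypothesis KN : reg c <= N.

Lemma step_prob_bernoulli m A B :
  step_prob R m G A B = bernoulli_mass (update_prob P m A) B.
Proof. by apply: eq_bigr => v _; rewrite opinion1_probE. Qed.

Lemma step_prob_ge0 m A B : 0 <= step_prob R m G A B.
Proof.
rewrite step_prob_bernoulli.
exact/bernoulli_mass_ge0/(update_prob_vector E).
Qed.

Lemma step_prob_sum m A : \sum_B step_prob R m G A B = 1.
Proof.
under eq_bigr do rewrite step_prob_bernoulli -[bernoulli_mass _ _]mulr1.
exact: bexp1.
Qed.

Lemma voting_unfinished m A (om : R) t k :
  0 < om -> om ^+ 2 <= even_tol c / N ->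
  evolve (step_prob R m G) (t + k) (fun B => (~~ consensus B)%:R) A <=
  (1 - rate c) ^+ k * (N / c * (N / reg c))
  + k%:R * (((3 / 4) ^+ t + 4 / (c * N)) / om).
Proof.
move=> om0 omN.
have /andP[c0 c1] := expander_c E; have N0 := expander_N_gt0 E.
have /andP[r0 r1] := rate_range (expander_c E).
have stepE f B : step_exp (step_prob R m G) f B = bexp (update_prob P m B) f.
  by apply: eq_bigr => C _; rewrite step_prob_bernoulli.
rewrite (_ : 4 / (c * N) = 1 / (c * N) / (1 - 3 / 4)); last first.
  by field; rewrite ?gt_eqF.
apply: (@evolve_unfinished _ _ _ _ _ (fun B => om < unevenness pi P B)
  (fun B => ~~ consensus B) (potential pi N c) (unevenness pi P)) => //.
- exact: step_prob_ge0.
- exact: step_prob_sum.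
- by lra.
- by rewrite divr_ge0 ?(ltW N0) ?(ltW c0).
- exact: (potential_range E).
- move=> B; rewrite /consensus negb_or => /andP[/finset.set0Pn[u uB] BT].
  have /fintype.subsetPn[v _ vB] : ~~ ([set: 'I_n]%SET \subset B).
    by rewrite finset.subTset.
  exact: (potential_split E KN uB vB).
- move=> B; rewrite -leNgt => wB; rewrite stepE.
  apply: (potential_step E) => //; apply: le_trans omN.
  by have /andP[w0 _] := unevenness_range E B; rewrite ler_sqr ?nnegrE // ltW.
- by apply/andP; split; lra.
- by rewrite divr_ge0 // mulr_ge0 // ltW.
- exact: (unevenness_range E).
- by move=> B; rewrite stepE; exact: (unevenness_step E).
- by move=> B /ltW.
Qed.

Lemma voting_finished m A t :
  1 - evolve (step_prob R m G) t (fun B => (~~ consensus B)%:R) A <=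
  evolve (step_prob R m G) t (fun B => (consensus B)%:R) A.
Proof.
rewrite addrC -mulN1r -(evolve_affine (step_prob_sum m)).
apply: (ler_evolve (step_prob_ge0 m)) => B.
by case: (consensus B); rewrite /= ?mulr0 ?add0r // mulr1 addNr.
Qed.

End VotingOnExpander.

(** * Logarithmic consensus time *)

Local Open Scope classical_set_scope.

(** With [u ^ 8] for the number of vertices all exponents are integral. The
    first term comes from the potential after [k] steps, the second one from
    the [k] times at which the unevenness might be large. *)
Lemma failure_bound (R : realFieldType) (c K sq e C0 u x y k : R) :
  0 < c -> 0 < K -> 0 < sq -> 0 < e -> 0 < C0 -> 1 <= u ->
  e / (c * K) + 8 * C0 * (e + 4 / c) / sq <= u ->
  0 <= x <= e / (u ^+ 8) ^+ 3 -> 0 <= y <= x -> 0 <= k <= 8 * C0 * u ->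
  x * (u ^+ 8 / c * (u ^+ 8 / K))
  + k * ((y + 4 / (c * u ^+ 8)) / (sq / u ^+ 4)) <= (u ^+ 2)^-1.
Proof.
move=> c0 K0 sq0 e0 C00 u1 Mu /andP[x0 xe] /andP[y0 yx] /andP[k0 ku].
have u0 : 0 < u by rewrite (lt_le_trans ltr01).
have un (j : nat) : 0 < u ^+ j by rewrite exprn_gt0.
pose M1 := e / (c * K); pose M2 := 8 * C0 * (e + 4 / c) / sq.
have M10 : 0 < M1 by rewrite divr_gt0 // mulr_gt0.
have cu0 : 0 < 4 / c by rewrite divr_gt0.
have t1 : x * (u ^+ 8 / c * (u ^+ 8 / K)) <= M1 / u ^+ 3.
  apply: (@le_trans _ _ (e / (u ^+ 8) ^+ 3 * (u ^+ 8 / c * (u ^+ 8 / K)))).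
    by rewrite ler_wpM2r // mulr_ge0 // divr_ge0 // ltW.
  have -> : e / (u ^+ 8) ^+ 3 * (u ^+ 8 / c * (u ^+ 8 / K)) = M1 / u ^+ 8.
    by rewrite /M1; field; rewrite !gt_eqF.
  rewrite ler_wpM2l ?(ltW M10) // lef_pV2 ?posrE //.
  by rewrite (ler_weXn2l u1).
have t2 : k * ((y + 4 / (c * u ^+ 8)) / (sq / u ^+ 4)) <= M2 / u ^+ 3.
  have om : 0 < sq / u ^+ 4 by rewrite divr_gt0.
  have y8 : y <= e / u ^+ 8.
    apply: le_trans yx (le_trans xe _).
    rewrite ler_wpM2l ?(ltW e0) // lef_pV2 ?posrE ?exprn_gt0 //.
    by rewrite -exprM (ler_weXn2l u1).
  apply: (@le_trans _ _ (8 * C0 * u * ((e / u ^+ 8 + 4 / (c * u ^+ 8)) / (sq / u ^+ 4)))).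
    apply: ler_pM => //.
      apply: divr_ge0 (ltW om); apply: addr_ge0 => //.
      by apply: divr_ge0 => //; rewrite mulr_ge0 // ltW.
    by rewrite ler_wpM2r ?invr_ge0 ?(ltW om) // lerD2r.
  rewrite le_eqVlt; apply/orP; left; apply/eqP.
  by rewrite /M2; field; rewrite !gt_eqF.
apply: le_trans (lerD t1 t2) _; rewrite -mulrDl ler_pdivrMr //.
by rewrite (_ : _ * u ^+ 3 = u) //; field; rewrite gt_eqF.
Qed.

(** Rounding the number of steps down loses at most a factor [expR 1]. *)
Lemma geometric_decay (R : realType) (r N : R) (k := Num.trunc (3 / r * ln N)) :
  0 < r <= 1 -> 1 <= N -> (1 - r) ^+ k <= expR 1 / N ^+ 3.
Proof.
move=> /andP[r0 r1] N1; have N0 : 0 < N by rewrite (lt_le_trans ltr01).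
have l0 : 0 <= 3 / r * ln N by rewrite mulr_ge0 ?ln_ge0 // divr_ge0 // ltW.
have /andP[_ kl] := truncn_itv l0; rewrite -/k -[X in _ < X]natr1 in kl.
apply: (@le_trans _ _ (expR (- r) ^+ k)).
  by rewrite lerXn2r ?nnegrE ?expR_ge0 ?subr_ge0 // expR_ge1Dx.
rewrite -expRM_natl.
have -> : expR 1 / N ^+ 3 = expR (1 - 3 * ln N).
  rewrite expRB; congr (_ / _).
  by rewrite (expRM_natl 3) lnK.
rewrite ler_expR.
have : r * (3 / r * ln N) <= r * (k%:R + 1) by rewrite ler_wpM2l ?(ltW r0) // ltW.
have -> : r * (3 / r * ln N) = 3 * ln N by field; rewrite gt_eqF.
lra.
Qed.

(** Number of steps per unit of [ln n] in either half of the process, and a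
    lower bound for the eighth root of [n]. *)
Definition log_factor (R : realType) (c : R) := 3 / rate c.
Definition size_bound (R : realType) (c : R) :=
  expR 1 / (c * reg c)
  + 8 * log_factor c * (expR 1 + 4 / c) / Num.sqrt (even_tol c).

Lemma even_tol_sqrt_gt0 (R : realType) (c : R) : 0 < c -> 0 < Num.sqrt (even_tol c).
Proof. by move=> c0; rewrite sqrtr_gt0 /even_tol !divr_gt0. Qed.

Lemma log_factor_gt0 (R : realType) (c : R) : 0 < c <= 1 -> 0 < log_factor c.
Proof. by move=> /rate_range/andP[r0 _]; rewrite divr_gt0. Qed.

Lemma size_bound_gt0 (R : realType) (c : R) : 0 < c <= 1 -> 0 < size_bound c.
Proof.
move=> c01; have c0 : 0 < c by have /andP[] := c01.
have e0 := expR_gt0 (1 : R).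
apply: addr_gt0; first exact: divr_gt0 e0 (mulr_gt0 c0 (reg_gt0 c01)).
apply: divr_gt0 (even_tol_sqrt_gt0 c0).
apply: mulr_gt0; first by apply: mulr_gt0 => //; exact: log_factor_gt0.
by apply: addr_gt0 => //; exact: divr_gt0.
Qed.

Lemma powR_eighth (R : realType) (N : R) (j : nat) : 0 < N ->
  N `^ (- (j%:R / 8)) = ((N `^ (1 / 8)) ^+ j)^-1.
Proof.
move=> N0; rewrite powRN -[_ ^+ j]powR_mulrn ?powR_ge0 // -powRrM.
by rewrite mulrC mulrAC mul1r mulrC.
Qed.

Lemma powR_eighth8 (R : realType) (N : R) : 0 < N -> (N `^ (1 / 8)) ^+ 8 = N.
Proof.
move=> N0; rewrite -powR_mulrn ?powR_ge0 // -powRrM mul1r mulVf //.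
by rewrite powRr1 // ltW.
Qed.

Lemma voting_consensus_time (R : realType) (n : nat) (G : graph n) (c lam : R) :
  expander (stationary R (adj G)) (transition R (adj G)) n%:R c lam ->
  (forall v, 0 < degree R (adj G) v) -> reg c <= n%:R -> 1 <= (n%:R : R) `^ (1 / 8) ->
  size_bound c <= n%:R `^ (1 / 8) ->
  forall (m : voting) (A : {set 'I_n})
    (d : measure_display) (T : measurableType d)
    (P : probability T R) (X : nat -> T -> {set 'I_n}),
  voting_process m G A P X ->
  ((1 - n%:R `^ (- (1 / 4)))%:E <=
   P [set w | (consensus_time R X w <= (2 * log_factor c * ln n%:R)%:E)%E])%E.
Proof.
set N : R := n%:R; set u := N `^ (1 / 8).
move=> E deg0 KN u1 Mu m A d T P X vp.
have c01 := expander_c E; have c0 : 0 < c by have /andP[] := c01.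
have N0 := expander_N_gt0 E; have /andP[r0 r1] := rate_range c01.
have N1 : 1 <= N by apply: le_trans KN; have := reg_ge c01; lra.
have sub_r : 3 / 4 <= 1 - rate c by lra.
have r01 : 0 < rate c <= 1 by rewrite r0; lra.
have C00 := log_factor_gt0 c01.
have u0 : 0 < u by exact: lt_le_trans u1.
have u8 : u ^+ 8 = N := powR_eighth8 N0.
have sq0 := even_tol_sqrt_gt0 c0.
have K0 := reg_gt0 c01.
have e0 := expR_gt0 (1 : R).
have l0 : 0 <= log_factor c * ln N := mulr_ge0 (ltW C00) (ln_ge0 N1).
have decay := geometric_decay r01 N1; rewrite -/(log_factor c) in decay.
set k := Num.trunc _ in decay.
have kle : k%:R <= log_factor c * ln N by rewrite truncn_le.
have kk : (k + k)%:R <= 2 * log_factor c * ln N.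
  by rewrite natrD -mulrA mulr_natl mulr2n lerD.
apply: le_trans (prob_consensus_at_le vp kk).
apply: le_trans (process_law vp _ _); rewrite lee_fin.
apply: le_trans (voting_finished E deg0 m A (k + k)).
rewrite lerD2l lerN2.
have om0 : 0 < Num.sqrt (even_tol c) / u ^+ 4 by rewrite divr_gt0 // exprn_gt0.
have om2 : (Num.sqrt (even_tol c) / u ^+ 4) ^+ 2 <= even_tol c / N.
  by rewrite expr_div_n sqr_sqrtr -?exprM ?u8 // ltW // -sqrtr_gt0.
apply: le_trans (voting_unfinished E deg0 KN m A k k om0 om2) _.
have q0 : (0 : R) <= 3 / 4 by rewrite divr_ge0.
have xe : 0 <= (1 - rate c) ^+ k <= expR 1 / (u ^+ 8) ^+ 3.
  by rewrite u8 decay andbT exprn_ge0 // (le_trans q0).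
have yx : 0 <= (3 / 4 : R) ^+ k <= (1 - rate c) ^+ k.
  by rewrite exprn_ge0 //= lerXn2r ?nnegrE // (le_trans q0).
have ku : 0 <= (k%:R : R) <= 8 * log_factor c * u.
  rewrite ler0n /=; apply: le_trans kle _.
  have -> : ln N = 8 * ln u by rewrite /u ln_powR; field.
  have lu := ltW (ln_sublinear u0).
  by rewrite mulrA [_ * 8]mulrC ler_wpM2l // mulr_ge0 // ltW.
have := failure_bound c0 K0 sq0 e0 C00 u1 Mu xe yx ku.
rewrite u8 -/N (_ : N `^ (- (1 / 4)) = (u ^+ 2)^-1) //.
by rewrite -powR_eighth //; congr (_ `^ (- _)); field.
Qed.

Theorem corollary1p6 (R : realType) (p : R) (p_gt0 : 0 < p) (p_le1 : p <= 1) :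
  exists C c c' : R, [/\ 0 < C, 0 < c, 0 < c' &
    \forall n \near \oo,
      1 - n%:R `^ (- c) <=
      gnp_prob p [set G : graph n |
        forall (m : voting) (A : {set 'I_n})
          (d : measure_display) (T : measurableType d)
          (P : probability T R) (X : nat -> T -> {set 'I_n}),
          voting_process m G A P X ->
          ((1 - n%:R `^ (- c'))%:E <=
           P [set w | (consensus_time R X w <= (C * ln n%:R)%:E)%E])%E]].
Proof.
pose c := p / 4.
have c0 : 0 < c by rewrite divr_gt0.
have c1 : c <= 1 by rewrite /c; lra.
have c01 : 0 < c <= 1 by rewrite c0.
pose Cg := 4 / c ^+ 4 + 11 / (c ^+ 2 / 100 / 100) ^+ 2.
have Cg0 : 0 < Cg.
  by apply: addr_gt0; apply: divr_gt0 => //; apply: exprn_gt0 => //;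
    rewrite !divr_gt0 ?exprn_gt0.
have M0 := size_bound_gt0 c01.
pose M := size_bound c + Cg + 1.
(* the failure probabilities are O(1 / n) and O(log n / sqrt n) *)
exists (2 * log_factor c), (1 / 2), (1 / 4); split=> //.
  by rewrite mulr_gt0 // log_factor_gt0.
near=> n.
have N2 : 2 <= n%:R :> R by near: n; exact: nbhs_infty_ger.
have NK : reg c <= n%:R by near: n; exact: nbhs_infty_ger.
have Nc : 1 / c <= n%:R by near: n; exact: nbhs_infty_ger.
have NM : M ^+ 8 <= n%:R by near: n; exact: nbhs_infty_ger.
have N0 : 0 < n%:R :> R by exact: lt_le_trans N2.
pose u : R := n%:R `^ (1 / 8).
have M1 : 1 <= M by rewrite /M lerDr addr_ge0 // ltW.
have Mb : size_bound c <= M by rewrite /M -addrA lerDl addr_ge0 // ltW.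
have MC : Cg <= M by rewrite /M -addrA addrCA lerDl addr_ge0 // ltW.
have uM : M <= u.
  rewrite -(ler_pXn2r (isT : (0 < 8)%N)) ?nnegrE ?powR_ge0 //.
    by rewrite /u powR_eighth8.
  exact: le_trans M1.
have u1 : 1 <= u by exact: le_trans uM.
have u0 : 0 < u by exact: lt_le_trans u1.
have cN : 1 <= c * n%:R by rewrite mulrC -ler_pdivrMr.
have p01 : 0 <= p <= 1 by rewrite (ltW p_gt0).
have n1 : (1 < n)%N by rewrite -(ler_nat R).
apply: le_trans (gnp_quasirandom p01 p_gt0 n1 _); last first.
  move=> G [degG devG] m A d T P X.
  have := @quasirandom_expander R 'I_n (adj G) (adj_sym G) p c c01.
  rewrite card_ord => /(_ cN degG devG) E.
  apply: (voting_consensus_time E) => //.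
    by move=> v; apply: lt_le_trans (degG v); rewrite mulr_gt0.
  exact: le_trans uM.
rewrite -/c -/Cg lerD2l lerN2.
have -> : n%:R `^ (- (1 / 2)) = (u ^+ 4)^-1.
  by rewrite -powR_eighth //; congr (_ `^ (- _)); field.
rewrite -[X in _ / X](powR_eighth8 N0) -/u ler_pdivrMr ?exprn_gt0 //.
rewrite (_ : _ * _ = u ^+ 4); last by field; rewrite gt_eqF.
apply: (le_trans MC); apply: (le_trans uM).
by rewrite -[leLHS]expr1; exact: ler_weXn2l.
Unshelve. all: by end_near.
Qed.
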